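(* Let $\beta>1$ be a real number and let $A_\beta=\{0,\ldots,\lceil\beta\rceil-1\}$. Normalization in base $\beta$ is computable by a finite Büchi automaton on the alphabet $A_\beta\times A_\beta$ if and only if $\beta$ is a Pisot number.
   Context: The canonical alphabet of base $\beta$ is $A_\beta=\{0,\ldots,\lceil\beta\rceil-1\}$. A $\beta$-representation on $A_\beta$ of a real number $x$ is an infinite word $x_1x_2\cdots$ over $A_\beta$ with $x=\sum_{i\ge1}x_i\beta^{-i}$. For $x\in[0,1]$, the (greedy) $\beta$-expansion of $x$ is the lexicographically greatest $\beta$-representation of $x$ on $A_\beta$. Normalization in base $\beta$ is the function which maps any $\beta$-representation on $A_\beta$ of a number $x\in[0,1]$ to the greedy $\beta$-expansion of $x$. It is computable by a finite Büchi automaton on $A_\beta\times A_\beta$ if its graph, i.e. the set of infinite words $(a_1,b_1)(a_2,b_2)\cdots$ over $A_\beta\times A_\beta$ such that $a_1a_2\cdots$ is a $\beta$-representation of some $x\in[0,1]$ and $b_1b_2\cdots$ is the greedy $\beta$-expansion of $x$, is recognizable by a finite Büchi automaton. An automaton over a finite alphabet $B$ is a directed graph with edges labeled by letters of $B$, with a set $Q$ of states, a set $I\subseteq Q$ of initial states and a set $T\subseteq Q$ of terminal states; it is finite if $Q$ is finite. An infinite path is successful if it starts in $I$ and goes infinitely often through $T$. The set of infinite words recognized by the (Büchi) automaton is the set of labels of its successful infinite paths. A set of infinite words is recognizable by a finite Büchi automaton if it is the set recognized by some finite such automaton (not necessarily deterministic). A Pisot number is a real algebraic integer greater than $1$ all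 of whose other Galois conjugates have modulus less than $1$. *)

(* Defs.v *)
From mathcomp Require Import all_boot all_order all_algebra.
From mathcomp Require Import complex.
From mathcomp Require Import all_classical all_reals all_analysis.

Set Implicit Arguments.
Unset Strict Implicit.
Unset Printing Implicit Defensive.

Import Order.TTheory GRing.Theory Num.Theory.
Import numFieldNormedType.Exports.

Local Open Scope classical_set_scope.
Local Open Scope ring_scope.

(* The letter of index [i] of the word [w_1 w_2 ...] is [w i.-1]. *)
Definition word (B : Type) := nat -> B.

Record buchi (B : finType) := Buchi {
  state : finType;
  edges : {set state * B * state};
  initial : {set state};
  terminal : {set state}
}.

Definition path_labeled (B : finType) (M : buchi B)
    (q : nat -> state M) (w : word B) : Prop :=
  forall i, (q i, w i, q i.+1) \in edges M.

Definition successful (B : finType) (M : buchi B) (q : nat -> state M) : Prop :=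
  q 0%N \in initial M /\ forall N, exists2 n, (N <= n)%N & q n \in terminal M.

Definition recognized (B : finType) (M : buchi B) : set (word B) :=
  [set w | exists2 q : nat -> state M, path_labeled q w & successful q].

Definition recognizable (B : finType) (L : set (word B)) : Prop :=
  exists M : buchi B, recognized M = L.

(* For [0 < beta] the absolute value only converts the ceiling to [nat]. *)
Notation digit beta := 'I_(`|Num.ceil beta|%N).

Definition representation (R : realType) (beta : R) (w : word (digit beta))
    (x : R) : Prop :=
  series (fun i => (w i)%:R * beta ^- i.+1) @ \oo --> x.
Arguments representation {R} beta w x.

Definition lex_lt (k : nat) (v w : word 'I_k) : Prop :=
  exists n, (forall i, (i < n)%N -> v i = w i) /\ (v n < w n)%N.

Definition lex_le (k : nat) (v w : word 'I_k) : Prop := v = w \/ lex_lt v w.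

Definition greedy_expansion (R : realType) (beta : R) (w : word (digit beta))
    (x : R) : Prop :=
  representation beta w x /\
  forall v : word (digit beta), representation beta v x -> lex_le v w.
Arguments greedy_expansion {R} beta w x.

Definition normalization_graph (R : realType) (beta : R) :
    set (word (digit beta * digit beta)%type) :=
  [set ab | exists x : R, [/\ 0 <= x <= 1,
    representation beta (fun i => (ab i).1) x &
    greedy_expansion beta (fun i => (ab i).2) x]].
Arguments normalization_graph {R} beta _.

Definition normalization_computable (R : realType) (beta : R) : Prop :=
  recognizable (normalization_graph beta).

(* The witness [p] is the minimal polynomial of [x] over the rationals. *)
Definition galois_conjugate (R : realType) (x z : R[i]) : Prop :=
  exists p : {poly rat}, [/\ p \is monic, irreducible_poly p,
    root (map_poly ratr p) x & root (map_poly ratr p) z].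

Definition pisot (R : realType) (beta : R) : Prop :=
  [/\ integralOver (intr : int -> R) beta, 1 < beta &
    forall z : R[i], galois_conjugate beta%:C%C z -> z != beta%:C%C ->
      `|z| < 1].

(* Main.v *)
(* Write d for the largest digit, and let Y be the set of values at beta of the
   integer polynomials with coefficients in [-d, d].

   If beta is Pisot, a set of values p(beta) that is bounded, with bounded
   coefficients of p, is finite, because the values of p at the other conjugates
   are bounded as well.  So an automaton can remember the exact difference of
   the two prefixes, as well as the bounds that greediness and the condition
   x <= 1 impose on the tail of the second word.

   Conversely, a state of the automaton determines the difference of the tails of
   the two words, which makes Y `&` [-1, 1] finite.  The orbit of 1 under the
   beta-transformation lies in this set, so it is finite and beta is an algebraic
   integer.  Let gamma <> beta be a conjugate with |gamma| >= 1.  When the orbit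
   first meets a digit smaller than d it yields 0 < t < 1 with t and t - 1 in Y,
   and by the Enestroem-Kakeya theorem the conjugate t' of t differs from t.
   Compare the greedy digits of x and of x + t mod 1: after n steps the difference
   of the remainders is some s in the finite set Y `&` [-1, 1], and the mean over
   x of its conjugate s' is gamma^n (t' - t).  The pairs of remainders form a
   finite Markov chain (the overlaps below), hence gamma is an eigenvalue of a
   stochastic matrix.  This forces gamma, and then beta, to be a root of unity. *)

Require Import Defs.
From mathcomp Require Import all_boot all_order all_algebra.
From mathcomp Require Import separable.
From mathcomp Require Import complex.
From mathcomp Require Import all_classical all_reals all_analysis.
From mathcomp Require Import ring lra zify.

Set Implicit Arguments.
Unset Strict Implicit.
Unset Printing Implicit Defensive.

Import Order.TTheory GRing.Theory Num.Theory.
Import numFieldNormedType.Exports.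

Local Open Scope classical_set_scope.
Local Open Scope ring_scope.

(** * Representations and greedy expansions *)

Definition drop_word (B : Type) (n : nat) (w : word B) : word B :=
  fun i => w (n + i)%N.

Definition cat_word (B : Type) (n : nat) (w v : word B) : word B :=
  fun i => if (i < n)%N then w i else v (i - n)%N.

Lemma drop_cat_word (B : Type) n (w v : word B) : drop_word n (cat_word n w v) = v.
Proof.
by apply/funext => i; rewrite /drop_word /cat_word ltnNge leq_addr /= addnC addnK.
Qed.

Section Expansions.
Variables (R : realType) (beta : R).
Hypothesis beta_gt1 : 1 < beta.
Local Notation k := `|Num.ceil beta|%N.
Local Notation digit := (digit beta).
Local Notation word := (word digit).
Local Notation rep := (representation beta).
Implicit Types (w v : word) (x y : R).
Local Ltac blra := have := beta_gt1; lra.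

Definition top : R := k%:R - 1.
(** The value of the constant word of top digits, hence the largest number that has a
    representation. *)
Definition bound : R := top / (beta - 1).

Lemma natr_digits : k%:R = (Num.ceil beta)%:~R :> R.
Proof.
by rewrite natr_absz ger0_norm // ceil_ge0; blra.
Qed.

Lemma ler_base_top : beta <= top + 1.
Proof.
by rewrite /top natr_digits; have := ceil_ge beta; blra.
Qed.

Lemma digits_gt1 : (1 < k)%N.
Proof. by rewrite -(ltr_nat R); have := ler_base_top; rewrite /top; blra. Qed.

Lemma bound_ge1 : 1 <= bound.
Proof. by rewrite /bound ler_pdivlMr; have := ler_base_top; blra. Qed.

Lemma bound_fix : beta * bound = top + bound.
Proof. by rewrite /bound; field; rewrite subr_eq0 gt_eqF. Qed.

Lemma digit_ge0 (a : digit) : 0 <= a%:R :> R.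
Proof. exact: ler0n. Qed.

Lemma digit_le (a : digit) : a%:R <= top :> R.
Proof. by rewrite /top lerBrDr natr1 ler_nat. Qed.

(** Bernoulli's linear lower bound is enough here. The lemma refutes a violated bound: the excess is
    multiplied by beta until it leaves a bounded set. *)
Lemma escape (e : nat -> R) M : 0 < e 0%N ->
  (forall n, 0 < e n -> beta * e n <= e n.+1) -> exists n, M < e n.
Proof.
move=> e0 He.
have H n : 0 < e n /\ e 0%N * (1 + n%:R * (beta - 1)) <= e n.
  elim: n => [|n [IH1 IH2]]; first by split=> //; rewrite mul0r addr0 mulr1.
  have H1 := He n IH1; have n0 : 0 <= n%:R :> R by exact: ler0n.
  have H4 : 0 < (beta - 1) * e n by rewrite mulr_gt0; blra.
  have H2 : 0 <= (beta - 1) * (n%:R * ((beta - 1) * e 0%N)).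
    have b0 : 0 <= beta - 1 by blra.
    by rewrite !mulr_ge0 // ltW.
  have H3 : 0 <= (beta - 1) * (e n - e 0%N * (1 + n%:R * (beta - 1))).
    by rewrite mulr_ge0; blra.
  by split; rewrite -?natr1; lra.
pose c := e 0%N * (beta - 1).
have c0 : 0 < c by rewrite mulr_gt0 //; blra.
have [_] := H (Num.truncn (`|M| / c)).+1; set m := Num.truncn _ => Hm.
exists m.+1; apply: lt_le_trans Hm.
have : `|M| / c < m.+1%:R by exact: truncnS_gt.
rewrite ltr_pdivrMr // /c => H1; have := ler_norm M; lra.
Qed.

Lemma ltr_expr_base M : exists n, M < beta ^+ n.
Proof.
by apply: (@escape (fun n => beta ^+ n)) => [|n _]; rewrite ?expr0 // exprS.
Qed.

(** This is [beta ^+ n] times the difference of [x] and the n-th partial sum. The word need not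
    represent [x]; at [x = 0] the value depends on the prefix alone. *)
Fixpoint tail w x n : R :=
  if n is n'.+1 then beta * tail w x n' - (w n')%:R else x.

Lemma tail_partial w x n :
  series (fun i => (w i)%:R * beta ^- i.+1) n = x - beta ^- n * tail w x n.
Proof.
have b0 : beta != 0 by rewrite gt_eqF //; blra.
elim: n => [|n IH]; first by rewrite /series /= big_geq // expr0 invr1; ring.
rewrite seriesSr IH /=.
by rewrite exprS; field; rewrite ?b0 ?expf_neq0.
Qed.

Lemma invr_base_cvg0 : (fun n => beta ^- n) @ \oo --> (0 : R).
Proof.
have -> : (fun n => beta ^- n) = (fun n => beta^-1 ^+ n).
  by apply/funext => n; rewrite exprVn.
apply: cvg_expr; rewrite ger0_norm ?invr_ge0; last blra.
by rewrite invf_lt1; blra.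
Qed.

Lemma rep_of_bounded w x M : (forall n, `|tail w x n| <= M) -> rep w x.
Proof.
move=> HM; rewrite /representation.
have -> : series (fun i => (w i)%:R * beta ^- i.+1) =
    (fun n => x - beta ^- n * tail w x n) by apply/funext => n; exact: tail_partial.
rewrite -[x in _ --> x]subr0; apply: cvgB; first exact: cvg_cst.
apply: norm_cvg0; apply: (@squeeze_cvgr _ _ _ _ (fun=> 0) (fun n => beta ^- n * M)).
- near=> n; rewrite normr_ge0 /= normrM ger0_norm ?invr_ge0 ?exprn_ge0 //; last blra.
  by apply: ler_wpM2l; rewrite ?invr_ge0 ?exprn_ge0 //; blra.
- exact: cvg_cst.
- rewrite -[X in _ --> X](mul0r M); apply: cvgM; [exact: invr_base_cvg0|exact: cvg_cst].
Unshelve. all: by end_near. Qed.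

(** The partial sums increase to [x], and by [bound_fix] the partial sums plus [beta ^- n * bound]
    decrease to [x]. *)
Lemma rep_tail_bounds w x : rep w x -> forall n, 0 <= tail w x n <= bound.
Proof.
move=> Hw n; set s := series (fun i => (w i)%:R * beta ^- i.+1).
have b0 : 0 < beta by blra.
have bn m : 0 < beta ^- m by rewrite invr_gt0 exprn_gt0.
have nds : nondecreasing_seq s.
  apply/nondecreasing_seqP => m; rewrite /s seriesSr lerDl.
  by rewrite mulr_ge0 ?digit_ge0 // ltW.
have nis : nonincreasing_seq (fun m => s m + beta ^- m * bound).
  apply/nonincreasing_seqP => m; rewrite /s seriesSr -addrA lerD2l.
  have -> : beta ^- m * bound = beta ^- m.+1 * (beta * bound).
    by rewrite exprS; field; rewrite (gt_eqF b0) expf_neq0 // gt_eqF.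
  rewrite bound_fix mulrDr lerD2r mulrC ler_wpM2l ?digit_le // ltW //.
have cs : (fun m => s m + beta ^- m * bound) @ \oo --> x.
  rewrite -[x]addr0 -(mul0r bound); apply: cvgD => //.
  by apply: cvgM; [exact: invr_base_cvg0|exact: cvg_cst].
have H1 : s n <= x.
  by rewrite -(cvg_lim _ Hw) //; apply: nondecreasing_cvgn_le => //; apply/cvg_ex; exists x.
have H2 : x <= s n + beta ^- n * bound.
  rewrite -(cvg_lim _ cs) //.
  by apply: (@nonincreasing_cvgn_ge _ _ nis); apply/cvg_ex; exists x.
move: H1 H2; rewrite /s (tail_partial w x) => H1 H2.
have {}H1 : 0 <= beta ^- n * tail w x n by blra.
have {}H2 : beta ^- n * tail w x n <= beta ^- n * bound by blra.
by move: H1 H2; rewrite pmulr_rge0 // ler_pM2l // => -> ->.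
Qed.

Lemma rep_exists w : exists x, rep w x.
Proof.
suff : cvgn (series (fun i => (w i)%:R * beta ^- i.+1)) by move/cvg_ex.
have b0 : 0 < beta by blra.
apply: nondecreasing_is_cvgn.
  apply/nondecreasing_seqP => m; rewrite seriesSr lerDl.
  by rewrite mulr_ge0 ?digit_ge0 // invr_ge0 exprn_ge0 // ltW.
(* The distance from a partial sum to [bound] is a scaled tail started at [bound], and such tails
   never drop below [bound]. *)
exists bound => _ [n _ <-]; rewrite (tail_partial _ bound).
rewrite lerBlDr lerDl mulr_ge0 // ?invr_ge0 ?exprn_ge0 //; first exact: ltW.
elim: n => [|n IH] /=; first by have := bound_ge1; blra.
rewrite subr_ge0 (le_trans (digit_le _)) //.
suff Hn : bound <= tail w bound n.
  have : beta * bound <= beta * tail w bound n by rewrite ler_pM2l.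
  by rewrite bound_fix; have := bound_ge1; blra.
elim: n {IH} => [|n IH] //=.
have : beta * bound <= beta * tail w bound n by rewrite ler_pM2l.
by rewrite bound_fix; have := digit_le (w n); blra.
Qed.

Lemma rep_uniq w x y : rep w x -> rep w y -> x = y.
Proof. by move=> Hx Hy; apply: (cvg_unique _ Hx Hy). Qed.



Lemma tail_drop w x n m : tail (drop_word n w) (tail w x n) m = tail w x (n + m).
Proof. by elim: m => [|m IH]; rewrite ?addn0 ?addnS //= IH. Qed.

Lemma rep_drop w x n : rep w x -> rep (drop_word n w) (tail w x n).
Proof.
move=> /rep_tail_bounds Hx; apply: (@rep_of_bounded _ _ bound) => m.
by rewrite tail_drop; have := Hx (n + m)%N; rewrite ler_norml; have := bound_ge1; blra.
Qed.

Lemma eq_tail w v x n : (forall i, (i < n)%N -> w i = v i) -> tail w x n = tail v x n.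
Proof.
elim: n => [|n IH] //= H; rewrite IH ?H // => i Hi.
by apply: H; rewrite ltnS ltnW.
Qed.

(** The cap at the top digit matters when [beta * x] reaches [k], for instance at [x = 1] with an
    integer beta. *)
Definition gdigit_subproof x : (minn (Num.truncn (beta * x)) k.-1 < k)%N.
Proof. by rewrite (leq_ltn_trans (geq_minr _ _)) // prednK // ltnW // digits_gt1. Qed.
Definition gdigit x : digit := Ordinal (gdigit_subproof x).

Lemma gdigit_le x : 0 <= x -> (gdigit x)%:R <= beta * x.
Proof.
move=> x0; have bx : 0 <= beta * x by rewrite mulr_ge0 //; blra.
apply: (@le_trans _ _ (Num.truncn (beta * x))%:R); last by rewrite truncn_le.
by rewrite ler_nat /= geq_minl.
Qed.

Lemma gdigit_lt_top x : 0 <= x -> (gdigit x < k.-1)%N ->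
  beta * x < (gdigit x)%:R + 1.
Proof.
move=> x0; have bx : 0 <= beta * x by rewrite mulr_ge0 //; blra.
have := truncnS_gt (beta * x); rewrite -natr1 /= => H1 H2.
rewrite (_ : minn _ _ = Num.truncn (beta * x)) //.
by move: H2; rewrite /minn; case: ifP => //; rewrite ltnn.
Qed.

Lemma gdigit_top x : (k.-1 <= gdigit x)%N -> (gdigit x)%:R = top.
Proof.
move=> H; rewrite /top; apply/eqP; rewrite eq_sym subr_eq natr1 eqr_nat.
by have := ltn_ord (gdigit x); have := digits_gt1; rewrite eqn_leq; lia.
Qed.

Fixpoint grem x n : R :=
  if n is n'.+1 then beta * grem x n' - (gdigit (grem x n'))%:R else x.
Definition gword x : word := fun n => gdigit (grem x n).

Lemma tail_gword x n : tail (gword x) x n = grem x n.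
Proof. by elim: n => //= n ->. Qed.

Lemma grem_step x : 0 <= x <= bound -> 0 <= beta * x - (gdigit x)%:R <= bound.
Proof.
move=> /andP[x0 xD]; rewrite subr_ge0 gdigit_le //=.
have [H|H] := ltnP (gdigit x) k.-1.
  by have := gdigit_lt_top x0 H; have := bound_ge1; blra.
have : beta * x <= beta * bound by rewrite ler_pM2l //; blra.
by rewrite (gdigit_top H) bound_fix; blra.
Qed.

Lemma grem_bounds x n : 0 <= x <= bound -> 0 <= grem x n <= bound.
Proof. by move=> Hx; elim: n => [|n IH] //=; exact: grem_step. Qed.

Lemma rep_gword x : 0 <= x <= bound -> rep (gword x) x.
Proof.
move=> Hx; apply: (@rep_of_bounded _ _ bound) => n.
by rewrite tail_gword ger0_norm; case/andP: (grem_bounds n Hx).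
Qed.



Lemma rep_cat n w v x : rep v (tail w x n) -> rep (cat_word n w v) x.
Proof.
move=> /rep_tail_bounds Hv.
have E : tail (cat_word n w v) x n = tail w x n.
  by apply: eq_tail => i Hi; rewrite /cat_word Hi.
have E2 m : tail (cat_word n w v) x (n + m) = tail v (tail w x n) m.
  elim: m => [|m IH]; rewrite ?addn0 ?addnS //= IH.
  by rewrite /cat_word ltnNge leq_addr /= addnC addnK.
apply: (@rep_of_bounded _ _ (bound + \sum_(i < n) `|tail (cat_word n w v) x i|)) => m.
have [H|H] := ltnP m n.
  rewrite (bigD1 (Ordinal H)) //= addrCA lerDl addr_ge0 //; last exact: sumr_ge0.
  by have := bound_ge1; blra.
rewrite -(subnKC H) E2 ger0_norm; last by case/andP: (Hv (m - n)%N).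
by rewrite (le_trans (_ : _ <= bound)) ?lerDl ?sumr_ge0 //; case/andP: (Hv (m - n)%N).
Qed.

(* Below the top digit, a tail of value at least 1 can be traded for an
   increment of the digit that precedes it, since every number in [0, bound]
   has a representation. *)
Lemma greedyP w x : greedy_expansion beta w x <->
  rep w x /\ forall n, (w n < k.-1)%N -> tail w x n.+1 < 1.
Proof.
split=> [[Hw Hmax]|[Hw Ht]]; split=> //.
- move=> n Hn; rewrite ltNge; apply/negP => H1.
  have HS : ((w n).+1 < k)%N by rewrite -ltn_predRL.
  pose u : word := fun i => if i == n then Ordinal HS else w i.
  have Eu : tail u x n = tail w x n.
    by apply: eq_tail => i Hi; rewrite /u ltn_eqF.
  have Eu1 : tail u x n.+1 = tail w x n.+1 - 1.
    by rewrite /= Eu /u eqxx /= -natr1; ring.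
  pose v := cat_word n.+1 u (gword (tail u x n.+1)).
  have Hv : rep v x.
    apply: rep_cat; apply: rep_gword; rewrite Eu1.
    by have := rep_tail_bounds Hw n.+1; blra.
  have vi i : (i < n)%N -> v i = w i.
    by move=> Hi; rewrite /v /cat_word ltnS ltnW // /u ltn_eqF.
  have vn : v n = Ordinal HS by rewrite /v /cat_word ltnSn /u eqxx.
  case: (Hmax v Hv) => [E|[m [H2 H3]]].
    by have := congr1 (fun a : digit => val a) vn; rewrite E /=; lia.
  have [Hmn|Hmn|Hmn] := ltngtP m n.
  + by rewrite vi // ltnn in H3.
  + by have := congr1 (fun a : digit => val a) (H2 n Hmn); rewrite vn /=; lia.
  + by rewrite Hmn vn /= in H3; lia.
- move=> v Hv; case: (pselect (v = w)) => [->|Hvw]; first by left.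
  right; have [n Hn] : exists n, v n != w n.
    apply: contrapT => H; apply: Hvw; apply/funext => n.
    by apply/eqP; apply: contrapT => /negP Hn; apply: H; exists n.
  pose m := ex_minn (ex_intro (fun n => v n != w n) n Hn).
  have [Hm Hmin] : v m != w m /\ forall i, (i < m)%N -> v i = w i.
    rewrite /m; case: ex_minnP => j Hj Hjm; split=> // i Hi.
    by apply/eqP; apply: contraTT Hi => Hi; rewrite -leqNgt; exact: Hjm.
  exists m; split=> //; rewrite ltn_neqAle Hm /= leqNgt; apply/negP => Hlt.
  (* A larger letter of [v] at the first difference would make its next tail smaller than that of
     [w] by at least 1, hence negative. *)
  have E : tail v x m = tail w x m by exact: eq_tail.
  have wm : (w m < k.-1)%N by rewrite (leq_trans Hlt) // -ltnS prednK // ltnW // digits_gt1.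
  have := Ht m wm; have := rep_tail_bounds Hv m.+1; rewrite /= E.
  have : (w m).+1%:R <= (v m)%:R :> R by rewrite ler_nat.
  by rewrite -natr1; blra.
Qed.

Lemma greedy_gword x : 0 <= x <= bound -> greedy_expansion beta (gword x) x.
Proof.
move=> Hx; apply/greedyP; split; first exact: rep_gword.
move=> n Hn; rewrite tail_gword /=; have /andP[H0 _] := grem_bounds n Hx.
by have := gdigit_lt_top H0 Hn; blra.
Qed.

End Expansions.

Arguments gdigit : simpl never.

(** * Recognizability bounds the spectrum *)

Definition ev (A : nzRingType) (x : A) (p : {poly int}) : A :=
  (map_poly intr p).[x].

Section Evaluation.
Variables (A : comNzRingType) (x : A).

Lemma evC c : ev x c%:P = c%:~R.
Proof. by rewrite /ev map_polyC hornerC. Qed.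

Lemma evX : ev x 'X = x.
Proof. by rewrite /ev map_polyX hornerX. Qed.

Lemma evD p q : ev x (p + q) = ev x p + ev x q.
Proof. by rewrite /ev rmorphD hornerD. Qed.

Lemma evN p : ev x (- p) = - ev x p.
Proof. by rewrite /ev rmorphN hornerN. Qed.

Lemma evM p q : ev x (p * q) = ev x p * ev x q.
Proof. by rewrite /ev rmorphM hornerM. Qed.

Lemma evXn n : ev x 'X^n = x ^+ n.
Proof. by rewrite /ev map_polyXn hornerXn. Qed.

Lemma evE p : ev x p = \sum_(i < size p) (p`_i)%:~R * x ^+ i.
Proof. by rewrite /ev horner_poly. Qed.

Lemma ev_step p c : ev x (p * 'X + c%:P) = x * ev x p + c%:~R.
Proof. by rewrite evD evM evX evC mulrC. Qed.

End Evaluation.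

Section BoundedPolynomials.
Variables (R : realType) (beta : R).

(** With [c = k.-1] this is the set Y of the introduction. The degree of the polynomial is free. *)
Definition spectrum (c : nat) : set R :=
  [set y | exists2 p : {poly int}, (forall i, `|(p`_i)%R| <= c)%N & ev beta p = y].

Lemma spectrum_step c y (e : int) : spectrum c y -> (`|e| <= c)%N ->
  spectrum c (beta * y + e%:~R).
Proof.
move=> [p Hp <-] He; exists (p * 'X + e%:P); last exact: ev_step.
by move=> [|i]; rewrite coefD coefMX coefC /= ?add0r ?addr0.
Qed.

Lemma spectrum_int c (e : int) : (`|e| <= c)%N -> spectrum c e%:~R.
Proof.
by move=> He; exists e%:P => [[|i]|]; rewrite ?coefC ?evC.
Qed.

Lemma spectrum_ind c (P : R -> Prop) : P 0 ->
  (forall y (e : int), P y -> (`|e| <= c)%N -> P (beta * y + e%:~R)) ->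
  forall y, spectrum c y -> P y.
Proof.
move=> P0 PS y [p Hp <-]; elim/poly_ind: p Hp => [|p e IH] Hp.
  by rewrite -polyC0 evC.
rewrite ev_step; apply: PS; last first.
  by have := Hp 0%N; rewrite coefD coefMX coefC /= add0r.
apply: IH => i; have := Hp i.+1.
by rewrite coefD coefMX coefC /= addr0.
Qed.

End BoundedPolynomials.

Section RecognizableSpectrum.
Variables (R : realType) (beta : R).
Hypothesis beta_gt1 : 1 < beta.
Local Notation k := `|Num.ceil beta|%N.
Local Notation digit := (digit beta).
Local Notation word := (word digit).
Local Notation rep := (representation beta).
Local Ltac blra := have := beta_gt1; lra.

Lemma tail_diff (w : word) x y n :
  tail w x n - tail w y n = beta ^+ n * (x - y).
Proof. by elim: n => [|n IH] /=; rewrite ?mul1r // exprS -mulrA -IH; ring. Qed.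

(* Two runs that meet in a state can be spliced, so the state determines the
   difference of the tails of the two components. *)
Lemma finite_tail_differences : normalization_computable beta ->
  exists2 S : set R, finite_set S & forall (x : R) (a b : word) n,
    0 <= x <= 1 -> rep a x -> greedy_expansion beta b x ->
    S (tail b x n - tail a x n).
Proof.
move=> [M HM].
pose at_state (q : state M) (s : R) := exists x (a b : word) (r : nat -> state M) n,
  [/\ rep a x, rep b x,
      path_labeled r (fun i => (a i, b i)) /\ successful r, r n = q &
      s = tail b x n - tail a x n].
have at_state_uniq q s s' : at_state q s -> at_state q s' -> s = s'.
  move=> [x [a [b [r [n [Ha Hb [Hp [Hi Hs]] Hq ->]]]]]].
  move=> [x' [a' [b' [r' [n' [Ha' Hb' [Hp' [Hi' Hs']] Hq' ->]]]]]].
  pose a2 := cat_word n a (drop_word n' a'); pose b2 := cat_word n b (drop_word n' b').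
  pose r2 := cat_word n r (drop_word n' r').
  have r2n : r2 n = r n by rewrite /r2 /cat_word ltnn subnn /drop_word addn0 Hq' Hq.
  have r2l i : (i <= n)%N -> r2 i = r i.
    by rewrite leq_eqVlt => /orP[/eqP->//|Hin]; rewrite /r2 /cat_word Hin.
  have r2g i : (n <= i)%N -> r2 i = r' (n' + (i - n))%N.
    by move=> Hin; rewrite /r2 /cat_word ltnNge Hin.
  have : normalization_graph beta (fun i => (a2 i, b2 i)).
    rewrite -HM; exists r2; last split.
    - move=> i; have [Hin|Hin] := ltnP i n.
        by rewrite r2l 1?ltnW // r2l // /a2 /b2 /cat_word Hin; exact: Hp.
      rewrite r2g // r2g 1?leqW // subSn // addnS /a2 /b2 /cat_word ltnNge Hin.
      exact: Hp'.
    - by rewrite r2l.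
    - move=> N; have [j Hj Hj2] := Hs' (n' + N)%N.
      exists (n + (j - n'))%N; first by lia.
      rewrite r2g ?leq_addr //.
      by have -> : (n' + (n + (j - n') - n) = j)%N by lia.
  move=> [x2 [Hx2 /= Ha2 [Hb2 _]]].
  have Ea : tail a2 x2 n = tail a' x' n'.
    apply: (@rep_uniq _ _ (drop_word n' a')); last exact: rep_drop.
    by rewrite -(drop_cat_word n a (drop_word n' a')); exact: rep_drop.
  have Eb : tail b2 x2 n = tail b' x' n'.
    apply: (@rep_uniq _ _ (drop_word n' b')); last exact: rep_drop.
    by rewrite -(drop_cat_word n b (drop_word n' b')); exact: rep_drop.
  have Ea2 : tail a2 x2 n = tail a x2 n.
    by apply: eq_tail => i Hin; rewrite /a2 /cat_word Hin.
  have Eb2 : tail b2 x2 n = tail b x2 n.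
    by apply: eq_tail => i Hin; rewrite /b2 /cat_word Hin.
  (* Replacing [x] by [x2] shifts the tails along [a] and along [b] by the same amount. *)
  have := tail_diff a x x2 n; have := tail_diff b x x2 n.
  by rewrite -Ea2 -Eb2 Ea Eb; lra.
(* States that no successful run visits get the default 0. *)
exists ((fun q => xget 0 (at_state q)) @` setT); first exact: finite_image.
move=> x a b n Hx Ha Hb.
have : normalization_graph beta (fun i => (a i, b i)) by exists x.
rewrite -HM => -[r Hp Hs]; exists (r n) => //.
apply: at_state_uniq (_ : at_state (r n) _).
  apply: (@xgetPex _ 0 (at_state (r n))).
  by exists (tail b x n - tail a x n), x, a, b, r, n; split=> //; case: Hb.
by exists x, a, b, r, n; split=> //; case: Hb.
Qed.

(** The positive and negative parts of the coefficients are digits, so [y] is a difference of two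
    prefix values [N1] and [N2]. The [m] leading zeros leave room to scale a number down into
    [0, 1]. *)
Lemma spectrum_words y : spectrum beta k.-1 y ->
  exists N1 N2 n, [/\ 0 <= N1, 0 <= N2, y = N1 - N2 &
    forall m, exists a1 a2 : word, forall x,
      tail a1 x (m + n) = beta ^+ (m + n) * x - N1 /\
      tail a2 x (m + n) = beta ^+ (m + n) * x - N2].
Proof.
have k0 : (0 < k)%N by apply: ltnW; exact: digits_gt1.
move: y; apply: spectrum_ind.
  exists 0, 0, 0%N; split=> [|||m]; rewrite ?subr0 //.
  pose z : word := fun=> Ordinal k0.
  have Hz x j : tail z x j = beta ^+ j * x.
    by elim: j => [|j IH] /=; rewrite ?mul1r // IH exprS -mulrA subr0.
  by exists z, z => x; rewrite Hz subr0.
move=> y e [N1 [N2 [n [N10 N20 -> Hw]]]] He.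
pose e1 := if (0 <= e)%R then `|e|%N else 0%N.
pose e2 := if (0 <= e)%R then 0%N else `|e|%N.
have Ee : e = e1%:Z - e2%:Z by rewrite /e1 /e2; case: ifP => ?; lia.
have He1 : (e1 < k)%N by rewrite /e1; case: ifP => ?; lia.
have He2 : (e2 < k)%N by rewrite /e2; case: ifP => ?; lia.
exists (beta * N1 + e1%:R), (beta * N2 + e2%:R), n.+1; split.
- by rewrite addr_ge0 // mulr_ge0 //; blra.
- by rewrite addr_ge0 // mulr_ge0 //; blra.
- by rewrite [in LHS]Ee intrB -!pmulrn; ring.
move=> m; have [a1 [a2 Ha]] := Hw m.
exists (fun i => if i == (m + n)%N then Ordinal He1 else a1 i).
exists (fun i => if i == (m + n)%N then Ordinal He2 else a2 i) => x.
have [H1 H2] := Ha x.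
rewrite addnS /= eqxx exprS.
rewrite (@eq_tail _ _ _ a1) ?H1; last by move=> i Hi; rewrite ltn_eqF.
rewrite (@eq_tail _ _ _ a2) ?H2; last by move=> i Hi; rewrite ltn_eqF.
by split; ring.
Qed.

(** Two representations of one number, with prefix values [N1] and [N2], are compared with the same
    greedy expansion; [y] is the difference of the two tail differences. *)
Lemma finite_spectrum : normalization_computable beta ->
  finite_set (spectrum beta k.-1 `&` [set y | `|y| <= 1]).
Proof.
move=> /finite_tail_differences[S finS HS].
apply: (sub_finite_set _ (finite_image2 (fun u v : R => u - v) finS finS)).
move=> y [/spectrum_words[N1 [N2 [n [N10 N20 -> Hw]]]] /=].
rewrite ler_norml => HN.
(* Since |y| <= 1, both [X - N1] and [X - N2] lie in [0, 1] and can serve as tails. *)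
pose X := Num.max N1 N2.
have HX : [/\ N1 <= X <= N1 + 1 & N2 <= X <= N2 + 1].
  by rewrite /X; case: (leP N1 N2) => ?; split; lra.
have {HX}[HX1 HX2] := HX.
have [m Hm] := ltr_expr_base beta_gt1 X.
have bm j : 0 < beta ^+ j by rewrite exprn_gt0 //; blra.
pose x := beta ^- (m + n) * X.
have Ex : beta ^+ (m + n) * x = X by rewrite /x mulVKf // gt_eqF.
have Hx : 0 <= x <= 1.
  have X0 : 0 <= X by lra.
  have bi : 0 <= beta ^- (m + n) by rewrite invr_ge0 ltW.
  rewrite /x mulr_ge0 //=.
  rewrite mulrC ler_pdivrMr // mul1r (le_trans (ltW Hm)) //.
  by apply: ler_weXn2l; [blra|exact: leq_addr].
have [a1 [a2 Ha]] := Hw m; have [H1 H2] := Ha x; rewrite Ex in H1 H2.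
pose b := gword beta_gt1 x.
have Hb : greedy_expansion beta b x.
  by apply: greedy_gword => //; have := bound_ge1 beta_gt1; lra.
have Htail (a : word) (N : R) : tail a x (m + n) = X - N -> N <= X <= N + 1 ->
    S (tail b x (m + n) - (X - N)).
  move=> Ea HN'; pose a' := cat_word (m + n) a (gword beta_gt1 (X - N)).
  have -> : X - N = tail a' x (m + n).
    by rewrite -Ea; apply: eq_tail => i Hi; rewrite /a' /cat_word Hi.
  apply: HS => //; apply: rep_cat => //; rewrite Ea; apply: rep_gword => //.
  by have := bound_ge1 beta_gt1; lra.
exists (tail b x (m + n) - (X - N1)); first exact: Htail H1 HX1.
exists (tail b x (m + n) - (X - N2)); first exact: Htail H2 HX2.
by ring.
Qed.

End RecognizableSpectrum.

(** * Peripheral eigenvalues *)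

Section Peripheral.
Variable C : numClosedFieldType.

(** Taking real parts leaves a vanishing sum of nonnegative terms, and a point of the closed unit
    disk with real part 1 is 1. *)
Lemma convex_combination_eq1 (I : finType) (w r : I -> C) :
  (forall i, 0 <= w i) -> (forall i, `|r i| <= 1) ->
  \sum_i w i * r i = \sum_i w i -> forall i, 0 < w i -> r i = 1.
Proof.
move=> w0 r1 Hsum i wi.
have Re1 j : 'Re (r j) <= 1 by rewrite (le_trans _ (r1 j)) // leif_Re_Creal.
have Hs : \sum_j w j * (1 - 'Re (r j)) = 0.
  under eq_bigr do rewrite mulrBr mulr1.
  rewrite sumrB -{1}Hsum; apply/eqP; rewrite subr_eq0; apply/eqP.
  have wr j : w j \is Num.real by rewrite ger0_real.
  transitivity ('Re (\sum_j w j * r j)).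
    by rewrite Hsum; apply/esym/Creal_ReP/sum_real.
  rewrite raddf_sum; apply: eq_bigr => j _ /=; exact: ReMl.
have := psumr_eq0P _ Hs.
move/(_ (fun j _ => mulr_ge0 (w0 j) _)) => Hi.
have {}Hi : w i * (1 - 'Re (r i)) = 0 by apply: Hi => // j; rewrite subr_ge0.
move/eqP: Hi; rewrite mulf_eq0 gt_eqF //= subr_eq0 => /eqP Hr.
have H1 : `|r i| = 1.
  by apply/eqP; rewrite eq_le r1 /= {1}Hr leif_Re_Creal.
have := leif_Re_Creal (r i); rewrite -Hr H1 => -[_ /esym]; rewrite eqxx.
by move/normr_idP; rewrite H1.
Qed.

Lemma max_norm (I : finType) (i0 : I) (y : I -> C) :
  exists i, forall j, `|y j| <= `|y i|.
Proof.
suff [i [_ Hi]] : exists i, i0 \in enum I /\ forall j, j \in enum I -> `|y j| <= `|y i|.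
  by exists i => j; apply: Hi; rewrite mem_enum.
have : i0 \in enum I by rewrite mem_enum.
move=> H0; suff [i Hi] : exists i, forall j, j \in enum I -> `|y j| <= `|y i|.
  by exists i.
elim: (enum I) => [|i s [m Hm]]; first by exists i0.
have [H|H] := real_leP (normr_real (y i)) (normr_real (y m)).
  by exists m => j; rewrite inE => /orP[/eqP->//|]; exact: Hm.
exists i => j; rewrite inE => /orP[/eqP->//|/Hm Hj].
exact: le_trans Hj (ltW H).
Qed.

(* The Perron-Frobenius argument: after division by the positive eigenvector
   [lam] the eigenvector [u] becomes a function [y] with [g * y i] the average
   of [y] over the children of [i], so at a point where [|y|] is maximal all
   children carry the value [g * y i]. *)
Lemma peripheral_root_of_unity (I E : finType) (child : I -> E -> option I)
    (lam u : I -> C) (b g : C) :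
  (forall i, 0 < lam i) -> 0 < b -> 1 <= `|g| ->
  (forall i, \sum_e oapp lam 0 (child i e) = b * lam i) ->
  (forall i, \sum_e oapp u 0 (child i e) = b * g * u i) ->
  (exists i, u i != 0) ->
  exists2 n, (0 < n)%N & g ^+ n = 1.
Proof.
move=> lam0 b0 g1 Hlam Hu [i1 ui1].
pose y i := u i / lam i.
have lamN i : lam i != 0 by rewrite gt_eqF.
have [i0 Hmax] := max_norm i1 y.
have y0 : y i0 != 0.
  rewrite -normr_gt0 (lt_le_trans _ (Hmax i1)) // normr_gt0.
  by rewrite mulf_neq0 // invr_eq0.
have gN : g != 0 by rewrite -normr_gt0 (lt_le_trans ltr01).
have step i : `|y i| = `|y i0| -> exists j, y j = g * y i.
  move=> Hi.
  have yN : y i != 0 by rewrite -normr_eq0 Hi normr_eq0.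
  pose w e := oapp lam 0 (child i e); pose r e := oapp y 0 (child i e) / (g * y i).
  have Hw e : 0 <= w e by rewrite /w; case: (child i e) => //= j; exact: ltW.
  have Hr e : `|r e| <= 1.
    have gy : 0 < `|g * y i| by rewrite normr_gt0 mulf_neq0.
    rewrite /r normrM normfV ler_pdivrMr // mul1r normrM Hi.
    case: (child i e) => [j|] /=; last by rewrite normr0 mulr_ge0.
    by rewrite (le_trans (Hmax j)) // ler_peMl.
  have Hs : \sum_e w e * r e = \sum_e w e.
    rewrite Hlam; transitivity ((\sum_e oapp u 0 (child i e)) / (g * y i)).
      rewrite mulr_suml; apply: eq_bigr => e _; rewrite /w /r mulrA; congr (_ / _).
      by case: (child i e) => [j|] /=; rewrite ?mulr0 // /y mulrC divfK.
    by rewrite Hu /y; field; rewrite gN lamN -(divfK (lamN i) (u i)) mulf_neq0.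
  have [e we] : exists e, w e != 0.
    apply: contrapT => H; have : \sum_e w e = 0.
      by apply: big1 => e _; apply/eqP/contraT => He; case: H; exists e.
    by move/eqP; rewrite Hlam mulf_eq0 !gt_eqF.
  have wp : 0 < w e by rewrite lt_neqAle eq_sym we Hw.
  have := convex_combination_eq1 Hw Hr Hs wp; move: we; rewrite /w /r.
  case: (child i e) => [j|] /=; last by rewrite eqxx.
  by move=> _ /divr1_eq Hj; exists j.
(* The value [g * y i0] is attained, so maximality gives |g| <= 1. *)
have Hnorm : `|g| = 1.
  have [j Hj] := step i0 erefl; have := Hmax j.
  rewrite Hj normrM ger_pMl ?normr_gt0 // => Hg.
  by apply/eqP; rewrite eq_le Hg g1.
have orbit n : exists j, y j = g ^+ n * y i0.
  elim: n => [|n [j Hj]]; first by exists i0; rewrite mul1r.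
  have [|l Hl] := step j; first by rewrite Hj normrM normrX Hnorm expr1n mul1r.
  by exists l; rewrite Hl Hj exprS mulrA.
pose f (n : 'I_#|I|.+1) := xget i0 [set j | y j = g ^+ n * y i0].
have fP n : y (f n) = g ^+ n * y i0.
  have [j Hj] := orbit n; exact: (@xgetPex _ i0 [set j | y j = _] (ex_intro _ j Hj)).
have /injectivePn[a [c Hac Hf]] : ~~ injectiveb f.
  apply/negP => /injectiveP/leq_card; rewrite card_ord; lia.
wlog ac : a c Hac Hf / (a < c)%N.
  move=> W; have [H|H|H] := ltngtP a c; first exact: W H.
    by apply: (W c a) => //; rewrite eq_sym.
  by move/eqP: Hac => []; exact: val_inj.
exists (c - a)%N; first by rewrite subn_gt0.
have := fP c; rewrite -Hf fP => /(mulIf y0).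
rewrite -{1}(subnK (ltnW ac)) exprD -{1}[g ^+ a]mul1r => /mulIf ->//.
by rewrite expf_neq0.
Qed.

(** Modulo the invariant space [K], [V] is an eigenvector, so p(A) V is p(c) V. For the
    characteristic polynomial p this puts p(c) V into [K]; as [l] vanishes on [K] but not at [V],
    p(c) = 0. *)
Lemma eigenvector_mod (n : nat) (A : 'M[C]_n.+1) (V : 'cV[C]_n.+1)
    (K : 'cV[C]_n.+1 -> Prop) (l : 'cV[C]_n.+1 -> C) (c : C) :
  K 0 -> (forall a f f', K f -> K f' -> K (a *: f + f')) ->
  (forall f, K f -> K (A *m f)) -> K (A *m V - c *: V) ->
  (forall a f, K f -> l (a *: V + f) = a * l V) -> l V != 0 ->
  exists2 u : 'cV[C]_n.+1, u != 0 & A *m u = c *: u.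
Proof.
move=> K0 KD KA KV Hl lV.
have Hp p : K (horner_mx A p *m V - p.[c] *: V).
  elim/poly_ind: p => [|p a IH].
    by rewrite rmorph0 mul0mx horner0 scale0r subr0.
  have -> : horner_mx A (p * 'X + a%:P) *m V - (p * 'X + a%:P).[c] *: V =
    A *m (horner_mx A p *m V - p.[c] *: V) + (p.[c] *: (A *m V - c *: V) + 0).
    rewrite mulrC rmorphD rmorphM /= horner_mx_X horner_mx_C hornerD hornerM.
    rewrite hornerX hornerC mulmxDl mul_scalar_mx -mulmxE -mulmxA mulmxBr.
    rewrite -scalemxAr scalerBr scalerA scalerDl [c * _]mulrC addr0.
    by rewrite opprD addrACA subrr addr0 addrA subrK.
  rewrite -[A *m _]scale1r; apply: (KD) => //; first exact: KA.
  exact: KD.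
have /eqP : (char_poly A).[c] = 0.
  have := Hp (char_poly A); rewrite Cayley_Hamilton mul0mx sub0r => HK.
  have := Hl (char_poly A).[c] _ HK; rewrite addrN.
  have := Hl 0 0 K0; rewrite scale0r addr0 mul0r => -> /esym/eqP.
  by rewrite mulf_eq0 (negbTE lV) orbF => /eqP.
(* Eigenvalues are defined through row vectors, hence the transpose. *)
have -> : char_poly A = char_poly A^T.
  by rewrite /char_poly -det_tr /char_poly_mx linearB /= tr_scalar_mx map_trmx.
rewrite -/(root _ _) -eigenvalue_root_char.
move=> /eigenvalueP[v Hv v0]; exists v^T.
  by apply: contraNneq v0 => E; rewrite -(trmxK v) E trmx0.
by rewrite -[A]trmxK -trmx_mul Hv linearZ.
Qed.

(* The Enestroem-Kakeya theorem.  Multiplied by [1 - z^-1], the relation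
   expresses 1 as a convex combination of powers of [z^-1]. *)
Lemma root_decreasing_coefs (n : nat) (h : nat -> C) (z : C) :
  h 0%N = 1 -> h n.+1 = 0 -> h 1%N < 1 ->
  (forall i, 0 <= h i) -> (forall i, h i.+1 <= h i) ->
  \sum_(i < n.+1) h i * z ^+ (n - i) = 0 -> `|z| < 1.
Proof.
move=> h0 hn h1 hp hd Hz; rewrite real_ltNge ?ger0_real //; apply/negP => z1.
have zN : z != 0 by rewrite -normr_gt0 (lt_le_trans ltr01).
pose u := z^-1.
have u1 : `|u| <= 1 by rewrite normfV invf_le1 // normr_gt0.
have Hu : \sum_(i < n.+1) h i * u ^+ i = 0.
  transitivity (u ^+ n * \sum_(i < n.+1) h i * z ^+ (n - i)); last by rewrite Hz mulr0.
  rewrite mulr_sumr; apply: eq_bigr => i _.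
  rewrite mulrCA; congr (_ * _); rewrite /u !exprVn.
  have Hi : (i <= n)%N by rewrite -ltnS.
  by rewrite -{2}(subnK Hi) exprD invfM mulrAC mulVf ?mul1r // expf_neq0.
pose w (i : 'I_n.+1) := h i - h i.+1; pose r (i : 'I_n.+1) := u ^+ i.+1.
have Hw i : 0 <= w i by rewrite subr_ge0.
have Hr i : `|r i| <= 1 by rewrite normrX exprn_ile1.
have Hs : \sum_i w i * r i = \sum_i w i.
  have -> : \sum_i w i = 1.
    rewrite /w -(big_mkord xpredT (fun i => h i - h i.+1)).
    under eq_bigr do rewrite -opprB.
    by rewrite sumrN telescope_sumr // opprB h0 hn subr0.
  rewrite /w /r; under eq_bigr do rewrite mulrBl exprS mulrCA.
  rewrite sumrB -mulr_sumr Hu mulr0 sub0r.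
  have : \sum_(i < n.+2) h i * u ^+ i = 0.
    by rewrite big_ord_recr /= Hu hn mul0r addr0.
  rewrite big_ord_recl /= h0 mulr1 => /eqP; rewrite addrC addr_eq0 => /eqP.
  by under eq_bigr do rewrite exprS; move=> ->; rewrite opprK.
(* By [h 1 < 1] the power [u] itself has positive weight. At [u = 1] the relation becomes a
   vanishing sum of nonnegative terms, one of which is 1. *)
have Eu : u = 1.
  have := @convex_combination_eq1 _ w r Hw Hr Hs ord0; rewrite /r /= expr1; apply.
  by rewrite /w /= h0 subr_gt0.
move: Hu; rewrite Eu big_ord_recl /= h0 mul1r => /eqP; apply/negP/lt0r_neq0.
by rewrite ltr_wpDr // sumr_ge0 // => i _; rewrite expr1n mulr1.
Qed.

End Peripheral.

(** * Overlaps of tiles *)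

Local Ltac split_ifs := rewrite ?/Order.min ?/Order.max;
  repeat match goal with |- context [if ?b then _ else _] =>
    lazymatch b with
    | context [if _ then _ else _] => fail
    | _ => let H := fresh in case: (boolP b) => [H|];
           [|rewrite -?leNgt -?ltNge => H]
    end
  end.

Section Increments.
Variables (R : realType) (V : zmodType).
Implicit Types (G : R -> V) (u v p c : R).

(** An arbitrary [G] acts as an additive interval function; empty intersections may stand in sums
    because they count 0. *)
Definition incr G u v : V := if u <= v then G v - G u else 0.

Lemma incr_split G u v c :
  incr G u (Num.min v c) + incr G (Num.max u c) v = incr G u v.
Proof.
rewrite /incr; split_ifs; rewrite ?addr0 ?add0r //; try (exfalso; lra).
all: try by rewrite addrC addrA subrK.
all: by have <- : u = c by [lra]; rewrite ?subrr ?add0r.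
Qed.

(** The cells [a + p, a + 1 + p] tile [p, n + p], and so do their intersections with [u, v] after
    restriction. *)
Lemma incr_telescope G u v p n :
  \sum_(a < n) incr G (Num.max u (a%:R + p)) (Num.min v (a%:R + 1 + p)) =
  incr G (Num.max u p) (Num.min v (n%:R + p)).
Proof.
elim: n => [|n IH].
  rewrite big_ord0 /incr add0r; split_ifs; rewrite ?subrr //; try (exfalso; lra).
  by have -> : u = p by [lra]; rewrite subrr.
rewrite big_ord_recr /= IH -natr1.
rewrite -(incr_split _ (Num.max u p) (Num.min v (n%:R + 1 + p)) (n%:R + p)).
have n0 : 0 <= n%:R :> R by exact: ler0n.
by congr (incr _ _ _ + incr _ _ _); split_ifs; lra.
Qed.

Definition clamp v : R := Num.max 0 (Num.min v 1).

Lemma incr_clamp G u v : u <= v ->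
  incr G (Num.max 0 u) (Num.min v 1) = G (clamp v) - G (clamp u).
Proof.
rewrite /incr /clamp => uv; split_ifs; rewrite ?subrr //; try (exfalso; lra).
  by have -> : u = 1 by [lra]; rewrite subrr.
by have -> : v = 0 by [lra]; rewrite subrr.
Qed.

End Increments.

(* A pair [(e, s)] encodes the overlap of the tile [0, 1] with its translate by
   [-s], cut at [e]: the interval from [lo s] to [e]. *)
Section Overlaps.
Variables (R : realType) (beta : R) (k : nat).
Hypothesis beta_gt1 : 1 < beta.
Hypothesis beta_le : beta <= k%:R.
Implicit Types (e s : R) (o : R * R).
Local Ltac blra := have := beta_gt1; have := beta_le; lra.

Definition lo s : R := Num.max 0 (- s).
Definition overlap o := [&& lo o.2 < o.1, o.1 <= 1 & o.1 + o.2 <= 1].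
(** If [x] and [x + s] have digits [a] and [b], their next remainders differ by
    [beta * s - (b - a)]. The new end is the stretched old one, cut by both unit cells. *)
Definition child o (a b : 'I_k) : R * R :=
  let s := beta * o.2 - (b%:R - a%:R) in
  (Num.min (Num.min (beta * o.1 - a%:R) 1) (1 - s), s).
Definition len o := o.1 - lo o.2.
Definition swap o : R * R := (o.1 + o.2, - o.2).

Lemma overlap_swap o : overlap (swap o) = overlap o.
Proof.
case: o => e s; rewrite /overlap /lo /= opprK addrK; split_ifs.
all: by apply/and3P/and3P; case=> *; split; lra.
Qed.

Lemma swap_child o a b : swap (child o a b) = child (swap o) b a.
Proof.
case: o => e s; rewrite /swap /child /=; congr pair; last by ring.
by split_ifs; lra.
Qed.

Lemma lo_swap o : lo (swap o).2 = lo o.2 + o.2.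
Proof.
by case: o => e s; rewrite /lo /= opprK; split_ifs; lra.
Qed.

Lemma overlap_child o a b : overlap (child o a b) = (lo (child o a b).2 < (child o a b).1).
Proof.
case: o => e s; rewrite /overlap /child /=; set x := Num.min _ _; set s' := _ - _.
rewrite (_ : (x <= 1) && (x + s' <= 1) = true) ?andbT //.
by apply/andP; rewrite /x /s'; split_ifs; split; lra.
Qed.

Section Values.
Variable W : zmodType.
Implicit Types G : R -> W.

(** The overlap is measured in the coordinate [x] of the first tile here, and in [x + s] for
    [incr2]. *)
Definition incr1 G o : W := G o.1 - G (lo o.2).
Definition incr2 G o : W := G (o.1 + o.2) - G (lo o.2 + o.2).

Lemma incr2E G o : incr2 G o = incr1 G (swap o).
Proof. by rewrite /incr2 /incr1 lo_swap. Qed.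

Lemma incr1_child G o a b :
  (if overlap (child o a b) then incr1 G (child o a b) else 0) =
  incr G (lo (child o a b).2) (child o a b).1.
Proof.
rewrite overlap_child /incr1 /incr le_eqVlt orbC.
by case: ltP => //= _; case: eqP => // ->; rewrite subrr.
Qed.

(** The cells [b] cover the stretched second tile because [beta <= k], so the children with fixed
    [a] partition the part of the stretched overlap in cell [a]. *)
Lemma sum_children_fixed G o (a : 'I_k) : overlap o ->
  \sum_(b < k) (if overlap (child o a b) then incr1 G (child o a b) else 0) =
  G (clamp (beta * o.1 - a%:R)) - G (clamp (beta * lo o.2 - a%:R)).
Proof.
case: o => e s /= /and3P[/= H1 H2 H3]; under eq_bigr do rewrite incr1_child.
have a0 : 0 <= a%:R :> R by exact: ler0n.
have bs : beta * (e + s) <= beta by rewrite ler_piMr //; blra.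
have bl : beta * lo s <= beta * e by rewrite ler_pM2l ?ltW //; blra.
rewrite -incr_clamp; last by lra.
have E (b : 'I_k) : incr G (lo (child (e, s) a b).2) (child (e, s) a b).1 =
  incr G (Num.max 0 (b%:R + - (beta * s + a%:R)))
    (Num.min (Num.min (beta * e - a%:R) 1) (b%:R + 1 + - (beta * s + a%:R))).
  by rewrite /lo /child /=; congr (incr _ (Num.max _ _) (Num.min _ _)); ring.
under eq_bigr do rewrite E.
rewrite incr_telescope; congr (incr _ _ _).
  rewrite /lo; have [s0|s0] := leP 0 s.
    have bs0 : 0 <= beta * s by rewrite mulr_ge0 //; blra.
    by split_ifs; lra.
  have bs0 : beta * s < 0 by rewrite pmulr_rlt0 //; blra.
  by split_ifs; lra.
by split_ifs; blra.
Qed.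

End Values.

Section Weighted.
Variable C : pzRingType.
Implicit Types (G : R -> C) (phi : nat -> C).

(** A transfer operator: its increments are the [phi]-weighted sums of the increments of [G] over
    the pieces into which the unit cells cut the stretched interval. *)
Definition refine phi G x : C := \sum_(a < k) phi a * G (clamp (beta * x - a%:R)).

Lemma sum_children1 phi G o : overlap o ->
  \sum_(a < k) \sum_(b < k)
    (if overlap (child o a b) then phi a * incr1 G (child o a b) else 0) =
  incr1 (refine phi G) o.
Proof.
move=> Ho; rewrite /incr1 /refine -sumrB; apply: eq_bigr => a _.
rewrite -mulrBr -(sum_children_fixed G a Ho) mulr_sumr.
by apply: eq_bigr => b _; case: ifP; rewrite ?mulr0.
Qed.

Lemma sum_children2 phi G o : overlap o ->
  \sum_(a < k) \sum_(b < k)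
    (if overlap (child o a b) then phi b * incr2 G (child o a b) else 0) =
  incr2 (refine phi G) o.
Proof.
move=> Ho; rewrite exchange_big incr2E -sum_children1 ?overlap_swap //.
apply: eq_bigr => b _; apply: eq_bigr => a _.
by rewrite -swap_child overlap_swap incr2E.
Qed.

End Weighted.

Lemma refine_id x : 0 <= x <= 1 -> refine (fun=> 1) id x = beta * x.
Proof.
move=> Hx; rewrite /refine.
have H n : \sum_(a < n) 1 * clamp (beta * x - a%:R) = Num.min (beta * x) n%:R.
  have bx : 0 <= beta * x by rewrite mulr_ge0 //; blra.
  elim: n => [|n IH]; first by rewrite big_ord0; split_ifs; lra.
  rewrite big_ord_recr /= IH mul1r -natr1 /clamp.
  by split_ifs; lra.
rewrite H; apply/min_idPl; apply: (le_trans _ beta_le).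
by rewrite ler_piMr //; blra.
Qed.

(** The children partition the stretched overlap. This makes [len] the positive eigenvector of the
    Perron-Frobenius argument. *)
Lemma sum_children_len o : overlap o ->
  \sum_(a < k) \sum_(b < k)
    (if overlap (child o a b) then len (child o a b) else 0) = beta * len o.
Proof.
move=> Ho; have := sum_children1 (fun=> 1) id Ho.
rewrite {2}/incr1 !refine_id -?mulrBr; last 2 first.
- move: Ho; case: o => e s /and3P[/= H1 H2 H3].
  by move: H1; rewrite /lo; split_ifs; lra.
- move: Ho; case: o => e s /and3P[/= H1 H2 H3].
  by move: H1; rewrite /lo; split_ifs; lra.
by move=> <-; apply: eq_bigr => a _; apply: eq_bigr => b _; rewrite mul1r.
Qed.

End Overlaps.

(** * Conjugates outside the open unit disk *)

Section Conjugate.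
Variables (R : realType) (beta : R) (gamma : R[i]).
Hypothesis beta_gt1 : 1 < beta.
Hypothesis gamma_conj : forall p, ev beta p = 0 -> ev gamma p = 0.
Local Notation k := `|Num.ceil beta|%N.
Local Notation spec := (spectrum beta k.-1).
Local Ltac blra := have := beta_gt1; lra.

(** The ring homomorphism from Z[beta] that sends p(beta) to p(gamma), well defined by [gamma_conj];
    the default 0 is taken elsewhere. *)
Definition conj (y : R) : R[i] :=
  xget 0 [set z | exists2 p, ev beta p = y & ev gamma p = z].

Lemma conj_ev p : conj (ev beta p) = ev gamma p.
Proof.
have H : [set z | exists2 q, ev beta q = ev beta p & ev gamma q = z] (ev gamma p).
  by exists p.
have [q Hq Hz] := @xgetPex _ 0 _ (ex_intro _ _ H).
rewrite /conj -Hz; apply/eqP; rewrite -subr_eq0 -evN -evD; apply/eqP/gamma_conj.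
by rewrite evD evN Hq subrr.
Qed.

Lemma conj_step c y (e : int) : spectrum beta c y ->
  conj (beta * y + e%:~R) = gamma * conj y + e%:~R.
Proof. by move=> [p _ <-]; rewrite -ev_step !conj_ev ev_step. Qed.

Lemma conj0 : conj 0 = 0.
Proof. by rewrite -[X in conj X](evC beta 0) conj_ev evC. Qed.

Hypothesis finite_spec : finite_set (spec `&` [set y | `|y| <= 1]).

(** The right end comes from one of the two tiles, so only one of its two coordinates is known to be
    in the spectrum. The condition passes to children and leaves finitely many overlaps. *)
Definition good (o : R * R) : Prop :=
  [/\ overlap o, spec o.2 & spec o.1 \/ spec (o.1 + o.2)].

Lemma good_child (o : R * R) (a b : 'I_k) : good o -> overlap (child beta o a b) ->
  good (child beta o a b).
Proof.
case: o => e s [Ho Hs He] Hc; split=> //=.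
  rewrite (_ : - _ = (a%:Z - b%:Z)%:~R); last by rewrite intrB opprB.
  by apply: spectrum_step => //; have := ltn_ord a; have := ltn_ord b; lia.
have k1 := digits_gt1 beta_gt1.
have spec1 : spec 1 by apply: (@spectrum_int _ _ _ 1); lia.
have Hd (c : 'I_k) y : spec y -> spec (beta * y - c%:R).
  move=> Hy; rewrite (_ : - _ = (- c%:Z)%:~R); last by rewrite intrN.
  by apply: spectrum_step => //; have := ltn_ord c; lia.
set s' := beta * s - _; set x := Num.min _ _.
have [Hx|[Hx|Hx]] : x = beta * e - a%:R \/ (x = 1 \/ x = 1 - s').
- by rewrite /x; split_ifs; lra.
- rewrite Hx; case: He => /= He; [left|right]; first exact: Hd.
  rewrite (_ : _ + s' = beta * (e + s) - b%:R); last by rewrite /s'; ring.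
  exact: Hd.
- by rewrite Hx; left.
- by rewrite Hx; right; rewrite subrK.
Qed.

Lemma finite_good : exists st : seq (R * R), forall o, o \in st <-> good o.
Proof.
have [F HF] := (finite_seqP _).1 finite_spec.
have inF y : spec y -> -1 <= y <= 1 -> y \in F.
  move=> H1 H2; have : [set` F] y by rewrite -HF; split=> //=; rewrite ler_norml.
  by [].
pose st := [seq (e, s) | e <- F, s <- F] ++ [seq (e - s, s) | e <- F, s <- F].
exists [seq o <- st | `[<good o>]] => o; rewrite mem_filter.
split; first by case/andP => /asboolP.
move=> H; rewrite (asboolT H) /= mem_cat; apply/orP.
case: o H => e s [/and3P[/= H1 H2 H3] Hs He].
have [H4 H5] : 0 <= lo s /\ - s <= lo s by rewrite /lo; split_ifs; lra.
have Fs : s \in F by apply: inF => //; lra.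
case: He => He; [left|right]; apply/allpairsP.
  by exists (e, s); split=> //=; apply: inF => //; lra.
exists (e + s, s); split=> //=; first by apply: inF => //; lra.
by rewrite addrK.
Qed.

Local Notation T f o := (\sum_(a < k) \sum_(b < k)
  (if overlap (child beta o a b) then f (child beta o a b) else 0)).

(** These functions are stable under summation over children and cancel in a rotation of the circle,
    so they can be divided out. *)
Definition cobound (G : R -> R[i]) (o : R * R) := incr2 G o - incr1 G o.

Lemma children_cobound G o : overlap o ->
  T (cobound G) o = cobound (refine beta k (fun=> 1) G) o.
Proof.
have bk : beta <= k%:R by have := ler_base_top beta_gt1; rewrite /top; lra.
move=> Ho; rewrite /cobound.
rewrite -(sum_children1 beta_gt1 bk (fun=> 1) G Ho).
rewrite -(sum_children2 beta_gt1 bk (fun=> 1) G Ho) -sumrB.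
apply: eq_bigr => a _; rewrite -sumrB; apply: eq_bigr => b _.
by case: ifP; rewrite ?mul1r ?subr0.
Qed.

(** The integral over the overlap of the conjugate of the displacement. *)
Definition weight (o : R * R) : R[i] := ((len o)%:C)%C * conj o.2.

(* Up to a coboundary, [weight] is an eigenvector for [beta * gamma]. *)
Lemma children_weight o : good o ->
  T weight o = (beta%:C)%C * gamma * weight o
    + cobound (refine beta k (fun a => - a%:R) (fun x => (x%:C)%C)) o.
Proof.
have bk : beta <= k%:R by have := ler_base_top beta_gt1; rewrite /top; lra.
move=> [Ho Hs _]; rewrite /cobound.
set phi : nat -> R[i] := fun a => - a%:R; set G := fun x : R => (x%:C)%C.
rewrite -(sum_children1 beta_gt1 bk phi G Ho) -(sum_children2 beta_gt1 bk phi G Ho).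
rewrite /weight mulrACA [gamma * _]mulrC mulrA -mulrA.
rewrite -(rmorphM (@real_complex R)) -(sum_children_len beta_gt1 bk Ho) /=.
rewrite -sumrB raddf_sum mulr_suml -big_split; apply: eq_bigr => a _ /=.
rewrite -sumrB raddf_sum mulr_suml -big_split; apply: eq_bigr => b _ /=.
case: ifP => [Hc|_]; last by rewrite mul0r !subr0 addr0.
(* The digit difference split off here, weighted by lengths, is what the coboundary collects. *)
have -> : conj (child beta o a b).2 = gamma * conj o.2 - (b%:R - a%:R).
  rewrite /= (_ : - (b%:R - a%:R) = (a%:Z - b%:Z)%:~R); last by rewrite intrB opprB.
  rewrite (conj_step _ Hs) intrB.
  by rewrite opprB.
have E1 : incr1 G (child beta o a b) = ((len (child beta o a b))%:C)%C.
  by rewrite /incr1 /G /len rmorphB.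
have E2 : incr2 G (child beta o a b) = ((len (child beta o a b))%:C)%C.
  by rewrite /incr2 /G /len -rmorphB; congr (_%:C)%C; ring.
by rewrite E1 E2 /phi; ring.
Qed.

Lemma conjugate_root_of_unity t : 0 < t < 1 -> spec t -> spec (t - 1) ->
  conj t != (t%:C)%C -> 1 <= `|gamma| -> exists2 n, (0 < n)%N & gamma ^+ n = 1.
Proof.
move=> t01 Ht Ht1 tN gamma1.
have bk : beta <= k%:R by have := ler_base_top beta_gt1; rewrite /top; lra.
have k1 := digits_gt1 beta_gt1.
have [st Hst] := finite_good.
(* Rotation by [t] moves [0, 1 - t] by [t] and [1 - t, 1] by [t - 1]. *)
pose o1 : R * R := (1 - t, t); pose o2 : R * R := (1, t - 1).
have g1 : good o1.
  split=> //=; last first.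
    by right; rewrite subrK; apply: (@spectrum_int _ _ _ 1); lia.
  by apply/and3P; rewrite /= /lo; split; [split_ifs| |]; lra.
have g2 : good o2.
  split=> //=; last first.
    by left; apply: (@spectrum_int _ _ _ 1); lia.
  by apply/and3P; rewrite /= /lo; split; [split_ifs| |]; lra.
case Est : (size st) => [|n].
  by move/Hst: g1; rewrite (size0nil Est).
pose at_ (i : 'I_n.+1) := nth o1 st i.
have at_good i : good (at_ i) by apply/Hst/mem_nth; rewrite Est.
pose idx o : 'I_n.+1 := inord (index o st).
have at_idx o : good o -> at_ (idx o) = o.
  move=> /Hst Ho; rewrite /at_ /idx inordK ?nth_index //.
  by rewrite -Est index_mem.
pose ch (i : 'I_n.+1) (e : 'I_k * 'I_k) : option 'I_n.+1 :=
  if overlap (child beta (at_ i) e.1 e.2) then Some (idx (child beta (at_ i) e.1 e.2))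
  else None.
have chE (V : zmodType) (f : R * R -> V) i :
    \sum_e oapp (f \o at_) 0 (ch i e) = T f (at_ i).
  rewrite pair_bigA; apply: eq_bigr => -[a b] _ /=.
  rewrite /ch /=; case: ifP => //= Hc.
  by rewrite at_idx //; exact: good_child.
pose A : 'M[R[i]]_n.+1 := \matrix_(i, j) \sum_e (ch i e == Some j)%:R.
have AE (v : 'cV[R[i]]_n.+1) i :
    (A *m v) i ord0 = \sum_e oapp (fun j => v j ord0) 0 (ch i e).
  rewrite mxE; under eq_bigr do rewrite mxE mulr_suml.
  rewrite exchange_big; apply: eq_bigr => e _ /=.
  case: (ch i e) => [j|] /=; last by apply: big1 => j _; rewrite mul0r.
  rewrite (bigD1 j) //= eqxx mul1r big1 ?addr0 // => l lj.
  rewrite (_ : (Some j == Some l) = false) ?mul0r //.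
  by apply/eqP => -[/esym/eqP]; apply/negP.
pose col (f : R * R -> R[i]) : 'cV[R[i]]_n.+1 := \col_i f (at_ i).
have Acol f i : (A *m col f) i ord0 = T f (at_ i).
  by rewrite AE -chE; apply: eq_bigr => e _; case: (ch i e) => //= j; rewrite mxE.
pose K (v : 'cV[R[i]]_n.+1) := exists G, v = col (cobound G).
pose l (v : 'cV[R[i]]_n.+1) := v (idx o1) ord0 + v (idx o2) ord0.
(* The two overlaps form the rotation of the circle by [t], so the increments
   of [G] before and after the rotation cancel. *)
have lK v : K v -> l v = 0.
  move=> [G ->]; rewrite /l !mxE !at_idx // /cobound /incr1 /incr2 /= /lo.
  have -> : Num.max 0 (- t) = 0 by split_ifs; lra.
  have -> : Num.max 0 (- (t - 1)) = 1 - t by split_ifs; lra.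
  have -> : 1 + (t - 1) = 1 - t + t + t - 1 by ring.
  have -> : 1 - t + (t - 1) = 0 by ring.
  have -> : 1 - t + t + t - 1 = t by ring.
  by rewrite subrK add0r; ring.
have lD a v w : l (a *: v + w) = a * l v + l w.
  by rewrite /l !mxE; ring.
have [] := @eigenvector_mod _ n A (col weight) K l ((beta%:C)%C * gamma).
- exists (fun=> 0); apply/colP => i; rewrite !mxE /cobound /incr1 /incr2.
  by rewrite !subr0.
- move=> a f f' [G ->] [G' ->]; exists (fun x => a * G x + G' x).
  by apply/colP => i; rewrite !mxE /cobound /incr1 /incr2; ring.
- move=> f [G ->]; exists (refine beta k (fun=> 1) G); apply/colP => i.
  by rewrite [RHS]mxE -children_cobound; [exact: Acol|case: (at_good i)].
- exists (refine beta k (fun a => - a%:R) (fun x => (x%:C)%C)); apply/colP => i.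
  rewrite [LHS]mxE (Acol weight i) children_weight; last exact: at_good.
  by rewrite !mxE addrAC subrr add0r.
- by move=> a f Kf; rewrite lD (lK f) // addr0.
(* With t' the conjugate of [t], the value is (1 - t) t' + t (t' - 1) = t' - t. *)
- rewrite /l !mxE !at_idx // /weight /len /= /lo.
  have -> : Num.max 0 (- t) = 0 by split_ifs; lra.
  have -> : Num.max 0 (- (t - 1)) = 1 - t by split_ifs; lra.
  have -> : conj (t - 1) = conj t - 1.
    case: Ht => p _ <-; rewrite (_ : _ - 1 = ev beta (p - 1)).
      by rewrite !conj_ev evD evN (_ : 1 = 1%:P) // evC.
    by rewrite evD evN (_ : 1 = 1%:P :> {poly int}) // evC.
  have -> : 1 - t - 0 = 1 - t by ring.
  have -> : 1 - (1 - t) = t by ring.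
  apply: contra_neq tN => E.
  apply/eqP; rewrite -subr_eq0 -E; apply/eqP.
  by rewrite rmorphB rmorph1; ring.
move=> u u0 Au.
apply: (@peripheral_root_of_unity _ 'I_n.+1 ('I_k * 'I_k)%type ch
  (fun i => (((len (at_ i)))%:C)%C) (fun i => u i ord0) (beta%:C)%C gamma) => //.
- move=> i; rewrite ltcR /len subr_gt0.
  by case: (at_good i) => /and3P[].
- by rewrite ltcR; blra.
- move=> i; rewrite -rmorphM -(sum_children_len beta_gt1 bk); last by case: (at_good i).
  rewrite -chE rmorph_sum; apply: eq_bigr => e _.
  by case: (ch i e).
- by move=> i; rewrite -AE Au mxE.
- apply: contrapT => H; move/eqP: u0 => []; apply/colP => i; rewrite mxE.
  by apply/eqP; apply: contraT => ui; case: H; exists i.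
Qed.

End Conjugate.

(** * The orbit of 1 *)

(** Coprimality survives field extension, so a common root in [L] makes the gcd over [F] nontrivial,
    hence associate to [q]. *)
Lemma irreducible_dvdp_root (F : fieldType) (L : fieldType) (f : {rmorphism F -> L})
    (p q : {poly F}) (x : L) : irreducible_poly q ->
  root (map_poly f q) x -> root (map_poly f p) x -> q %| p.
Proof.
move=> [_ irr] rq rp; have [c1|c1] := eqVneq (size (gcdp q p)) 1%N.
  have : coprimep (map_poly f q) (map_poly f p) by rewrite coprimep_map /coprimep c1.
  by move=> /coprimep_root /(_ rq); rewrite (rootP rp) eqxx.
have /irr /(_ (dvdp_gcdl q p)) := c1.
by rewrite /eqp => /andP[_ /dvdp_trans]; apply; exact: dvdp_gcdr.
Qed.

Lemma ev_ratr (L : numFieldType) (x : L) p :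
  ev x p = (map_poly ratr (map_poly (intr : int -> rat) p)).[x].
Proof.
rewrite /ev -map_poly_comp; congr (_.[x]); apply: eq_map_poly => c /=.
by rewrite ratr_int.
Qed.

Lemma ev_real (R : realType) (x : R) p : ev (x%:C)%C p = ((ev x p)%:C)%C.
Proof.
rewrite /ev -(horner_map (@real_complex R)) -map_poly_comp; congr (_.[_]).
by apply: eq_map_poly => c /=; rewrite rmorph_int.
Qed.

Lemma galois_conjugate_ev (R : realType) (x z : R[i]) p :
  galois_conjugate x z -> ev x p = 0 <-> ev z p = 0.
Proof.
move=> [q [_ irr rx rz]]; rewrite !ev_ratr.
by split=> /rootP rp; apply/rootP;
  [have := irreducible_dvdp_root irr rx rp|have := irreducible_dvdp_root irr rz rp];
  rewrite -(dvdp_map (ratr : {rmorphism rat -> R[i]})) => /dvdpP[r ->];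
  rewrite rootM ?rx ?rz orbT.
Qed.

Section Orbit.
Variables (R : realType) (beta : R).
Hypothesis beta_gt1 : 1 < beta.
Local Notation k := `|Num.ceil beta|%N.
Local Notation spec := (spectrum beta k.-1).
Local Ltac blra := have := beta_gt1; lra.

(* [orbit n] is the n-th iterate of 1 under the beta-transformation. *)
Local Notation orbit := (grem beta_gt1 1).
Local Notation odigit n := (gdigit beta_gt1 (orbit n)).

Lemma orbit_bounds n : 0 <= orbit n <= 1.
Proof.
elim: n => [|n /= /andP[IH0 IH1]]; first by rewrite ler01 lexx.
rewrite subr_ge0 gdigit_le //=.
have [H|H] := ltnP (odigit n) k.-1.
  by have := gdigit_lt_top IH0 H; lra.
rewrite (gdigit_top H); have := ler_base_top beta_gt1.
have : beta * orbit n <= beta by rewrite ler_piMr //; blra.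
lra.
Qed.

Fixpoint orbit_poly n : {poly int} :=
  if n is n'.+1 then orbit_poly n' * 'X + (- (odigit n')%:Z)%:P else 1.

Lemma ev_orbit_poly n : ev beta (orbit_poly n) = orbit n.
Proof.
elim: n => [|n IH]; first by rewrite /= (_ : 1 = 1%:P :> {poly int}) // evC.
by rewrite [orbit_poly _]/= ev_step IH /= intrN.
Qed.

Lemma size_orbit_poly n : size (orbit_poly n) = n.+1.
Proof.
elim: n => [|n IH] /=; first by rewrite size_poly1.
by rewrite size_MXaddC IH /= -size_poly_eq0 IH.
Qed.

Lemma monic_orbit_poly n : orbit_poly n \is monic.
Proof.
elim: n => [|n IH] /=; first exact: monic1.
rewrite monicE lead_coefDl ?lead_coefMX -?monicE //.
rewrite size_mulX -?size_poly_eq0 ?size_orbit_poly //.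
by rewrite (leq_ltn_trans (size_polyC_leq1 _)).
Qed.

Lemma orbit_spec n : spec (orbit n).
Proof.
have k1 := digits_gt1 beta_gt1.
elim: n => [|n IH] /=; first by apply: (@spectrum_int _ _ _ 1); lia.
rewrite -[X in _ - X]/((odigit n)%:Z%:~R) -intrN; apply: spectrum_step => //.
by have := ltn_ord (odigit n); lia.
Qed.

(** By finiteness two points of the orbit of 1 coincide. Their polynomials are monic of different
    degrees, so the difference is, up to order, monic with root beta. *)
Lemma integral_of_finite_spectrum :
  finite_set (spec `&` [set y | `|y| <= 1]) -> integralOver (intr : int -> R) beta.
Proof.
move=> /finite_seqP[F HF].
have inF n : orbit n \in F.
  have : [set` F] (orbit n); last by [].
  rewrite -HF; split; first exact: orbit_spec.
  by have := orbit_bounds n; rewrite /= ler_norml; lra.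
pose f (n : 'I_(size F).+1) : 'I_(size F).+1 := inord (index (orbit n) F).
have /injectivePn[a [c Hac Hf]] : ~~ injectiveb f.
  apply/negP => /injectiveP inj.
  have Hlt i : (f i < size F)%N.
    by rewrite inordK ?index_mem // ltnS index_size.
  pose g i := Ordinal (Hlt i).
  have /leq_card : injective g by move=> i j /(congr1 val) /= /val_inj /inj.
  by rewrite !card_ord ltnn.
have {}Hf : orbit a = orbit c.
  have := congr1 val Hf; rewrite /= !inordK ?ltnS ?index_size // => E.
  by rewrite -(nth_index 0 (inF a)) E nth_index.
wlog ac : a c Hac Hf / (a < c)%N.
  move=> W; have [H|H|H] := ltngtP a c; first exact: W H.
    by apply: (W c a) => //; rewrite eq_sym.
  by move/eqP: Hac => []; exact: val_inj.
exists (orbit_poly c - orbit_poly a).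
  rewrite monicE lead_coefDl -?monicE ?monic_orbit_poly //.
  by rewrite size_polyN !size_orbit_poly ltnS.
by apply/rootP; rewrite -/(ev beta _) evD evN !ev_orbit_poly Hf subrr.
Qed.

(** Horner's scheme: dividing [orbit_poly n] by X - beta gives a quotient whose coefficients are the
    orbit points. *)
Lemma ev_orbit_poly_sub n (z : R[i]) :
  ev z (orbit_poly n) - ((orbit n)%:C)%C =
  (z - (beta%:C)%C) * \sum_(i < n) ((orbit i)%:C)%C * z ^+ (n.-1 - i).
Proof.
elim: n => [|n IH].
  by rewrite big_ord0 mulr0 /= (_ : 1 = 1%:P :> {poly int}) // evC rmorph1 subrr.
rewrite [orbit_poly _]/= ev_step [orbit n.+1]/=.
have -> : ((beta * orbit n - (odigit n)%:R)%:C)%C =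
   (beta%:C)%C * ((orbit n)%:C)%C - (odigit n)%:R :> R[i].
  by rewrite rmorphB rmorphM rmorph_nat.
rewrite big_ord_recr /= subnn mulr1.
have -> : \sum_(i < n) ((orbit i)%:C)%C * z ^+ (n - i) =
    z * \sum_(i < n) ((orbit i)%:C)%C * z ^+ (n.-1 - i).
  rewrite mulr_sumr; apply: eq_bigr => i _; rewrite mulrCA -exprS; congr (_ * _ ^+ _).
  by have := ltn_ord i; lia.
rewrite mulrDr mulrCA -IH intrN; ring.
Qed.

(** If every digit were the top one, [bound beta - orbit n] would grow by the factor beta; it starts
    positive because [beta < k] means that [bound beta] exceeds 1. *)
Lemma first_small_digit : beta < k%:R -> exists2 n, (odigit n < k.-1)%N &
  forall i, (i < n)%N -> (odigit i)%:R = top beta.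
Proof.
move=> bk.
have H : exists n, (odigit n < k.-1)%N.
  apply: contrapT => H.
  have Hd n : (odigit n)%:R = top beta.
    by apply: gdigit_top => //; rewrite leqNgt; apply/negP => ?; apply: H; exists n.
  suff [n] : exists n, bound beta < bound beta - orbit n.
    by have := orbit_bounds n; lra.
  apply: (@escape _ _ beta_gt1 (fun n => bound beta - orbit n)).
  - rewrite /= subr_gt0 /bound ltr_pdivlMr; first by rewrite /top; lra.
    by blra.
  - move=> n _ /=; rewrite Hd.
    by have := bound_fix beta_gt1; lra.
exists (ex_minn H); first by case: ex_minnP.
case: ex_minnP => n _ Hn i Hi; apply: gdigit_top => //.
by rewrite leqNgt; apply: contraL Hi => /Hn; rewrite -leqNgt.
Qed.

Lemma pisot_of_finite_spectrum :
  finite_set (spec `&` [set y | `|y| <= 1]) -> pisot beta.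
Proof.
move=> Hfin; split=> //; first exact: integral_of_finite_spectrum.
move=> z Hz zb.
have conj_z p : ev beta p = 0 <-> ev z p = 0.
  rewrite -(galois_conjugate_ev p Hz) ev_real; split; first by move=> ->.
  by move/eqP; rewrite fmorph_eq0 => /eqP.
rewrite real_ltNge ?normr_real //; apply/negP => z1.
(* If beta were the integer [k], its only conjugate would be itself. *)
have bk : beta < k%:R.
  rewrite lt_neqAle; apply/andP; split; last first.
    by have := ler_base_top beta_gt1; rewrite /top; lra.
  apply: contra_neq zb => bk.
  have /conj_z : ev beta ('X + (- k%:Z)%:P) = 0 by rewrite evD evX evC intrN {1}bk subrr.
  rewrite evD evX evC intrN => /eqP; rewrite subr_eq0 => /eqP ->.
  by rewrite {2}bk rmorph_nat.
have [n Hn Htop] := first_small_digit bk.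
set t := orbit n.+1.
have tE : t = beta * orbit n - (odigit n)%:R by [].
have t01 : 0 <= t <= 1 := orbit_bounds n.+1.
have t1 : t < 1.
  have /andP[orb0 _] := orbit_bounds n.
  by have := gdigit_lt_top orb0 Hn; rewrite tE; lra.
have conj_t : conj beta z t != (t%:C)%C.
  rewrite /t -ev_orbit_poly (conj_ev (fun p => (conj_z p).1)) ev_orbit_poly.
  rewrite -subr_eq0 ev_orbit_poly_sub mulf_eq0 subr_eq0 (negbTE zb) /=.
  apply/negP => /eqP Hs.
  (* While the digits are top, the orbit does not increase, since [orbit i <= 1] and
     [beta - 1 <= top beta]. *)
  pose h i : R[i] := if (i <= n)%N then ((orbit i)%:C)%C else 0.
  have : `|z| < 1; last by rewrite real_ltNge ?normr_real // z1.
  have orbit1 : (0 < n)%N -> orbit 1%N < 1.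
    by move=> /Htop /= E; rewrite /= E mulr1; move: bk; rewrite /top; lra.
  have c0 : (0%:C)%C = 0 :> R[i] by [].
  have c1 : (1%:C)%C = 1 :> R[i] by [].
  apply: (@root_decreasing_coefs _ n h).
  - by [].
  - by rewrite /h ltnn.
  - rewrite /h; case: ifP => [/orbit1 o1|_]; last exact: ltr01.
    by rewrite -c1 ltcR.
  - move=> i; rewrite /h; case: ifP => // _; rewrite -c0 lecR.
    by case/andP: (orbit_bounds i).
  - move=> i; rewrite /h; case: ifP => [Hi|_]; last first.
      by case: ifP => // _; rewrite -c0 lecR; case/andP: (orbit_bounds i).
    rewrite ltnW // lecR /= Htop //; have /andP[_ y1] := orbit_bounds i.
    have : 0 <= (beta - 1) * (1 - orbit i) by rewrite mulr_ge0 // subr_ge0 // ltW.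
    by have := ler_base_top beta_gt1; lra.
  - rewrite -[RHS]Hs; apply: eq_bigr => i _; rewrite /h.
    by rewrite (_ : (i <= n)%N) // -ltnS.
have t0 : 0 < t.
  rewrite lt_neqAle eq_sym; case/andP: t01 => -> _; rewrite andbT.
  apply: contra_neq conj_t => ->.
  by rewrite (conj0 (fun p => (conj_z p).1)).
(* The digit at [n] is below the top, so its increment is still an admissible coefficient. *)
have Ht1 : spec (t - 1).
  rewrite (_ : t - 1 = beta * orbit n + (- ((odigit n)%:Z + 1))%:~R); last first.
    by rewrite tE intrN intrD; ring.
  by apply: spectrum_step; [exact: orbit_spec|lia].
have t01' : 0 < t < 1 by rewrite t0.
have [m m0 zm] := conjugate_root_of_unity beta_gt1 (fun p => (conj_z p).1) Hfin
  t01' (orbit_spec n.+1) Ht1 conj_t z1.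
have : ev beta ('X^m - 1) = 0.
  by apply/conj_z; rewrite evD evN evXn zm (_ : 1 = 1%:P :> {poly int}) // evC subrr.
rewrite evD evN evXn (_ : 1 = 1%:P :> {poly int}) // evC => /eqP.
by rewrite subr_eq0 => /eqP E; have := exprn_egt1 m beta_gt1; rewrite E ltxx eqn0Ngt m0.
Qed.

End Orbit.

Theorem computable_pisot (R : realType) (beta : R) : 1 < beta ->
  normalization_computable beta -> pisot beta.
Proof.
by move=> b1 /(finite_spectrum b1); exact: pisot_of_finite_spectrum.
Qed.

(** * Finiteness for Pisot bases *)

Local Notation pZtoQ := (map_poly (intr : int -> rat)).

(** By Gauss's lemma the rational minimal polynomial is associate to an integral factor of a monic
    annihilator; the leading coefficient of that factor is 1 or -1. *)
Lemma minimal_int_poly (R : realType) (x : R) : integralOver (intr : int -> R) x ->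
  exists m : {poly int}, [/\ m \is monic, irreducible_poly (pZtoQ m) & ev x m = 0].
Proof.
move=> [q qm /rootP qx].
pose P n := `[< exists p : {poly rat},
  [/\ p != 0, size p = n & root (map_poly ratr p) x] >].
have exP : exists n, P n.
  exists (size (pZtoQ q)); apply/asboolP; exists (pZtoQ q); split=> //.
    by rewrite map_poly_eq0_id0 ?monic_neq0 // intr_eq0 lead_coef_eq0 monic_neq0.
  by apply/rootP; rewrite -ev_ratr.
case: (ex_minnP exP) => n /asboolP[p [p0 sp px]] Hmin.
have irr : irreducible_poly p.
  split.
    rewrite ltnNge; apply/negP => /size1_polyC E; move: px p0.
    by rewrite E map_polyC /= rootC fmorph_eq0 polyC_eq0 => /eqP ->; rewrite eqxx.
  move=> d d1 /dvdpP[r Er].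
  have /andP[r0 d0] : (r != 0) && (d != 0) by rewrite -negb_or -mulf_eq0 -Er.
  move: px; rewrite Er rmorphM rootM => /orP[rx|dx].
    have : (n <= size r)%N by apply: Hmin; apply/asboolP; exists r.
    rewrite -sp Er size_mul //; have : (0 < size d)%N by rewrite size_poly_gt0.
    by move: d1; case: (size d) => [|[|v]] //= _ _; rewrite !addnS /= ltnNge leq_addr.
  have Hd : (n <= size d)%N by apply: Hmin; apply/asboolP; exists d.
  rewrite -Er -dvdp_size_eqp; last by rewrite Er dvdp_mull.
  rewrite eqn_leq sp Hd andbT -sp dvdp_leq // Er dvdp_mull //.
have pq : p %| pZtoQ q.
  by apply: (irreducible_dvdp_root irr px); apply/rootP; rewrite -ev_ratr.
have [p1 [a a0 Ep] [r Eq]] := dvdpP_rat_int pq.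
have [r1 p1l] : lead_coef r * lead_coef p1 = 1 /\ lead_coef p1 * lead_coef p1 = 1.
  have H : lead_coef p1 * lead_coef r = 1 by rewrite -lead_coefM -Eq (monicP qm).
  rewrite mulrC; split=> //; move: H.
  move/(congr1 absz)/eqP; rewrite abszM muln_eq1 => /andP[/eqP H _].
  have [->|->] // : lead_coef p1 = 1 \/ lead_coef p1 = -1 by lia.
exists (lead_coef p1 *: p1).
have l0 : lead_coef p1 != 0 by apply: contra_eq_neq p1l => ->; rewrite mul0r.
have Em : pZtoQ (lead_coef p1 *: p1) %= p.
  rewrite map_polyZ Ep eqp_sym; apply: (eqp_trans (eqp_scale _ a0)).
  by rewrite eqp_sym; apply: eqp_scale; rewrite intr_eq0.
split.
- by rewrite monicE lead_coefZ p1l.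
- case: irr => s1 Hirr; split=> [|d d1]; first by rewrite (eqp_size Em).
  by rewrite (eqp_dvdr _ Em) => /(Hirr _ d1) /eqp_trans; apply; rewrite eqp_sym.
- rewrite ev_ratr; apply/rootP.
  by have : map_poly (ratr : rat -> R) (pZtoQ (lead_coef p1 *: p1)) %= map_poly ratr p;
    [rewrite eqp_map|move=> /eqp_root ->].
Qed.

(** An irreducible rational polynomial is coprime to its nonzero derivative, so its roots are
    simple. *)
Lemma monic_int_roots (C : numClosedFieldType) (m : {poly int}) : m \is monic ->
  irreducible_poly (pZtoQ m) -> exists2 s : seq C, uniq s &
    map_poly (intr : int -> C) m = \prod_(z <- s) ('X - z%:P).
Proof.
move=> mm irr; set mC := map_poly _ m.
have EC : mC = map_poly ratr (pZtoQ m).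
  by rewrite -map_poly_comp; apply: eq_map_poly => c /=; rewrite ratr_int.
have mCm : mC \is monic by rewrite monic_map.
have [s Es] := closed_field_poly_normal mC.
move: Es; rewrite (monicP mCm) scale1r => Es; exists s => //.
rewrite -separable_prod_XsubC -Es EC separable_map.
set p := pZtoQ m in irr *.
rewrite unlock; apply: contraT => nc.
have p0 : p != 0.
  by apply/eqP => E; case: irr => s1 _; move: s1; rewrite E size_poly0.
have : p %= gcdp p p^`().
  by rewrite eqp_sym; apply: irr.2; [exact: nc|exact: dvdp_gcdl].
have p'0 : p^`() != 0.
  case: irr => s1 _; apply/eqP => E.
  have := congr1 (fun r : {poly rat} => r`_(size p).-2) E.
  rewrite coef_deriv coef0 => /eqP; rewrite mulrn_eq0 /= => H; move: H.
  have -> : (size p).-2.+1 = (size p).-1 by case: (size p) s1 => [|[]].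
  by rewrite -[_`__]/(lead_coef p) lead_coef_eq0 (negbTE p0).
move=> /eqp_dvdl E; have : p %| p^`() by rewrite E dvdp_gcdr.
by move/(dvdp_leq p'0); rewrite leqNgt lt_size_deriv.
Qed.

(** The inverse of a Vandermonde matrix recovers the coefficients from the values. *)
Lemma coef_bound_of_values (C : numFieldType) (s : seq C) (B : C) : uniq s -> 0 <= B ->
  exists2 K : C, 0 <= K & forall p : {poly C}, (size p <= size s)%N ->
    (forall z, z \in s -> `|p.[z]| <= B) -> forall i, `|p`_i| <= K.
Proof.
move=> us B0; set n := size s.
pose a : 'rV[C]_n := \row_j s`_j.
pose V := Vandermonde n a.
have uV : V \in unitmx.
  rewrite unitmxE unitfE det_Vandermonde; apply/prodf_neq0 => i _.
  apply/prodf_neq0 => j ij; rewrite !mxE subr_eq0 nth_uniq //.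
  by rewrite gt_eqF // ltEnat.
exists (\sum_i \sum_j B * `|invmx V j i|).
  by apply: sumr_ge0 => i _; apply: sumr_ge0 => j _; exact: mulr_ge0.
move=> p sp Hp i; have [Hi|Hi] := ltnP i n; last first.
  rewrite nth_default ?(leq_trans sp) // normr0.
  by apply: sumr_ge0 => l _; apply: sumr_ge0 => j _; exact: mulr_ge0.
pose c : 'rV[C]_n := \row_j p`_j.
have Ev j : (c *m V) ord0 j = p.[s`_j].
  rewrite mxE (horner_coef_wide _ sp); apply: eq_bigr => l _.
  by rewrite !mxE.
have -> : p`_i = (c *m V *m invmx V) ord0 (Ordinal Hi) by rewrite mulmxK // mxE.
rewrite (bigD1 (Ordinal Hi)) //= mxE.
apply: (le_trans (ler_norm_sum _ _ _)).
apply: ler_wpDr.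
  by apply: sumr_ge0 => l _; apply: sumr_ge0 => j _; exact: mulr_ge0.
apply: ler_sum => j _; rewrite normrM; apply: ler_wpM2r => //.
by rewrite Ev; apply: Hp; exact: mem_nth.
Qed.

Lemma norm_ev_lt1 (C : numFieldType) (z : C) (c : nat) (p : {poly int}) : `|z| < 1 ->
  (forall i, (`|(p`_i)%R| <= c)%N) -> `|ev z p| <= c%:R / (1 - `|z|).
Proof.
move=> z1 Hp; have z0 : 0 < 1 - `|z| by rewrite subr_gt0.
rewrite ler_pdivlMr // evE.
apply: (@le_trans _ _ ((\sum_(i < size p) c%:R * `|z| ^+ i) * (1 - `|z|))).
  apply: ler_wpM2r; first exact: ltW.
  apply: (le_trans (ler_norm_sum _ _ _)); apply: ler_sum => i _.
  rewrite normrM normrX; apply: ler_wpM2r; first exact: exprn_ge0.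
  by rewrite -intr_norm -abszE -pmulrn ler_nat.
rewrite -mulr_sumr -mulrA -[leRHS]mulr1; apply: ler_wpM2l => //.
by rewrite mulrC -opprB mulNr -subrX1 opprB lerBlDr lerDl exprn_ge0.
Qed.

Lemma finite_int_polys (n c : nat) :
  finite_set [set p : {poly int} | (size p <= n)%N /\ forall i, (`|(p`_i)%R| <= c)%N].
Proof.
pose g (f : {ffun 'I_n -> 'I_(c.*2.+1)}) : {poly int} :=
  \poly_(i < n) (if insub i is Some j then (f j)%:Z - c%:Z else 0).
apply: (@sub_finite_set _ _ (g @` setT)); last exact: finite_image.
move=> p [sp Hp]; exists [ffun j : 'I_n => inord (absz (p`_j + c%:Z))] => //.
apply/polyP => i; rewrite coef_poly; case: ifPn => Hi; last first.
  by rewrite nth_default // (leq_trans sp) // leqNgt.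
rewrite insubT /= ffunE /=; move: (Hp i); move: p`_i => e He.
have H : (`|(e + c%:Z)%R| < c.*2.+1)%N by rewrite -addnn; lia.
by rewrite inordK //; lia.
Qed.

Lemma finite_bounded_spectrum (R : realType) (beta : R) (c : nat) (M : R) :
  pisot beta -> finite_set (spectrum beta c `&` [set y | `|y| <= M]).
Proof.
move=> [int_beta beta1 Hconj].
have [m [mm irr mb]] := minimal_int_poly int_beta.
have [s us Es] := monic_int_roots R[i] mm irr.
have sm : size m = (size s).+1.
  rewrite -(size_prod_XsubC s id) -Es size_map_poly_id0 //.
  by rewrite intr_eq0 lead_coef_eq0 monic_neq0.
have ms z : z \in s -> ev z m = 0.
  by move=> zs; apply/rootP; rewrite Es root_prod_XsubC.
have galois z : z \in s -> galois_conjugate (beta%:C)%C z.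
  move=> zs; exists (pZtoQ m); split=> //; first by rewrite monic_map.
    by apply/rootP; rewrite -ev_ratr ev_real mb.
  by apply/rootP; rewrite -ev_ratr ms.
pose B : R[i] := (`|M|%:C)%C + \sum_(z <- s) `|c%:R / (1 - `|z|)|.
have B0 : 0 <= B by rewrite addr_ge0 ?sumr_ge0 // -(rmorph0 (@real_complex R)) lecR.
have [K K0 HK] := coef_bound_of_values us B0.
pose N := (Num.truncn (complex.Re K)).+1.
have KN : K < N%:R.
  have K1 : K = ((complex.Re K)%:C)%C by rewrite RRe_real // ger0_real.
  by rewrite K1 -(rmorph_nat (@real_complex R)) ltcR truncnS_gt.
apply: (sub_finite_set _ (finite_image (ev beta) (finite_int_polys (size s) N))).
move=> y [[p Hp <-] /= HM].
(* Reduction modulo [m] keeps the values at all roots and leaves at most as many coefficients as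
   there are roots, so bounded values leave finitely many [r]. *)
pose r := Pdiv.Ring.rmodp p m.
have Hr (A : comNzRingType) (z : A) : ev z m = 0 -> ev z r = ev z p.
  move=> z0; rewrite [in RHS](Pdiv.RingMonic.rdivp_eq mm p) -/r.
  by rewrite evD evM z0 mulr0 add0r.
have sr : (size r <= size s)%N.
  by rewrite -ltnS -sm Pdiv.Ring.ltn_rmodpN0 // monic_neq0.
exists r; last exact: Hr.
split=> // i; rewrite -ltnS.
have : `|(map_poly (intr : int -> R[i]) r)`_i| <= K.
  apply: HK; first by rewrite (leq_trans (size_poly _ _)).
  move=> z zs; rewrite -/(ev z r) Hr ?ms //.
  have [->|zb] := eqVneq z (beta%:C)%C.
    rewrite ev_real normc_def /= expr0n addr0 sqrtr_sqr /B ler_wpDr ?sumr_ge0 //.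
    by rewrite lecR (le_trans HM) // ler_norm.
  have z1 := Hconj z (galois z zs) zb.
  rewrite (le_trans (norm_ev_lt1 z1 Hp)) // /B (big_rem z) //= addrCA.
  have M0 : 0 <= (`|M|%:C)%C :> R[i] by rewrite -(rmorph0 (@real_complex R)) lecR.
  have H : c%:R / (1 - `|z|) <= `|c%:R / (1 - `|z|)|.
    by apply: real_ler_norm; rewrite ger0_real // divr_ge0 // subr_ge0 ltW.
  by rewrite (le_trans H) // lerDl addr_ge0 // sumr_ge0.
move=> /le_lt_trans /(_ KN).
by rewrite coef_map /= -intr_norm -abszE -pmulrn ltr_nat => /ltnW.
Qed.

(** * The normalizing automaton *)

Section Normalizer.
Variables (R : realType) (beta : R).
Hypothesis beta_gt1 : 1 < beta.
Local Notation k := `|Num.ceil beta|%N.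
Local Notation digit := (digit beta).
Local Notation word := (word digit).
Local Notation rep := (representation beta).
Local Ltac blra := have := beta_gt1; lra.

(** As a cap this imposes nothing on tails, and being an integer it lies in a spectrum. *)
Let M := (Num.truncn (bound beta)).+1.

Lemma bound_lt : bound beta < M%:R.
Proof. exact: truncnS_gt. Qed.

Lemma cap_ge1 : 1 <= M%:R :> R.
Proof. by have := bound_lt; have := bound_ge1 beta_gt1; lra. Qed.

(** The bound that greediness puts on the tail after the letter [b]; the top digit imposes none. *)
Definition cap (b : digit) : R := if (b < k.-1)%N then 1 else M%:R.

Lemma cap_le b : cap b <= M%:R.
Proof. by rewrite /cap; case: ifP => // _; exact: cap_ge1. Qed.

(** Starting at 0 makes this depend on the prefixes only. If the words have the same value, it is
    the difference of their tails. *)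
Definition discrepancy (a b : word) n : R := tail b 0 n - tail a 0 n.

(* The tail of [b] after [n] letters has to stay below [threshold b n]. *)
Fixpoint threshold (b : word) n : R :=
  if n is n'.+1
  then Num.min (beta * threshold b n' - (b n')%:R) (cap (b n')) else M%:R.

(** Here the fresh constraint is strictly sharper than the inherited one. Its recurrence is the
    Büchi condition, which excludes a tail that stays equal to its threshold. *)
Definition slack (b : word) n : bool :=
  cap (b n) < beta * threshold b n - (b n)%:R.

(** The same propagation for [x <= 1]. This inequality is weak, so nonnegativity at all times
    suffices. *)
Fixpoint ceiling (b : word) n : R :=
  if n is n'.+1
  then Num.min (beta * ceiling b n' - (b n')%:R) M%:R else 1.

Lemma threshold_le b n : threshold b n <= M%:R.
Proof. by case: n => //= n; rewrite ge_min cap_le orbT. Qed.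

Lemma ceiling_le b n : ceiling b n <= M%:R.
Proof. by case: n => /= [|n]; [exact: cap_ge1|rewrite ge_min lexx orbT]. Qed.

(** The discrepancy differs from the bounded difference of the tails by [beta ^+ n * (x - y)]. *)
Lemma discrepancyP (a b : word) x y : rep a x -> rep b y ->
  (forall n, `|discrepancy a b n| <= M%:R) <-> x = y.
Proof.
move=> Ha Hb.
have E n : discrepancy a b n = tail b y n - tail a x n + beta ^+ n * (x - y).
  have := tail_diff a 0 x n; have := tail_diff b 0 y n.
  by rewrite /discrepancy !sub0r !mulrN mulrBr; lra.
have Bd n : `|tail b y n - tail a x n| <= bound beta.
  have := rep_tail_bounds beta_gt1 Ha n; have := rep_tail_bounds beta_gt1 Hb n.
  by rewrite ler_norml; lra.
split=> [Hn|xy n]; last first.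
  have d0 : x - y = 0 by rewrite xy subrr.
  by rewrite E d0 mulr0 addr0 (le_trans (Bd n)) // ltW // bound_lt.
apply/eqP; rewrite -subr_eq0; apply: contraT => xy.
have d0 : 0 < `|x - y| by rewrite normr_gt0.
have [n] := ltr_expr_base beta_gt1 ((M%:R + bound beta) / `|x - y|).
rewrite ltr_pdivrMr // ltNge; case/negP.
have -> : beta ^+ n * `|x - y| = `|discrepancy a b n - (tail b y n - tail a x n)|.
  rewrite E addrAC subrr add0r normrM [`|beta ^+ n|]ger0_norm // exprn_ge0 //.
  by blra.
by rewrite (le_trans (ler_normB _ _)) // lerD.
Qed.

Lemma ceilingP (b : word) x : rep b x ->
  (forall n, 0 <= ceiling b n) <-> x <= 1.
Proof.
move=> /(rep_tail_bounds beta_gt1) Hb; split=> [Hc|x1 n].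
  rewrite leNgt; apply/negP => x1.
  suff [n] : exists n, bound beta < tail b x n - ceiling b n.
    by have := Hb n; have := Hc n; lra.
  apply: (@escape _ _ beta_gt1 (fun n => tail b x n - ceiling b n)).
    by rewrite /= subr_gt0.
  move=> n _ /=; set m := Num.min _ _.
  have : m <= beta * ceiling b n - (b n)%:R by rewrite /m ge_min lexx.
  lra.
suff : tail b x n <= ceiling b n by have := Hb n; lra.
elim: n => [|n IH] //=; rewrite le_min; apply/andP; split.
  by rewrite lerD2r ler_pM2l //; blra.
by have := Hb n.+1; have := bound_lt; rewrite /=; lra.
Qed.

(* While [tail] exceeds [threshold] the excess is multiplied by [beta], and it
   becomes positive at a position with [slack]. *)
Lemma thresholdP (b : word) x : rep b x ->
  (forall n, 0 < threshold b n) /\ (forall N, exists2 n, (N <= n)%N & slack b n)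
  <-> forall n, (b n < k.-1)%N -> tail b x n.+1 < 1.
Proof.
move=> /(rep_tail_bounds beta_gt1) Hb.
have b0 : 0 < beta by blra.
split=> [[Hpos Hinf]|Ht].
  suff Hlt n : tail b x n < threshold b n.
    move=> n Hn; have := Hlt n.+1; rewrite [threshold _ _]/= /cap Hn lt_min.
    by case/andP.
  rewrite ltNge; apply/negP => HN.
  have Hge j : threshold b (n + j) <= tail b x (n + j).
    elim: j => [|j IH]; first by rewrite addn0.
    by rewrite addnS /= ge_min lerD2r ler_pM2l // IH.
  have [m Hm Hs] := Hinf n.
  have Hm0 : threshold b m <= tail b x m by rewrite -(subnKC Hm).
  suff [j] : exists j, bound beta < tail b x (m.+1 + j) - threshold b (m.+1 + j).
    by have := Hb (m.+1 + j)%N; have := Hpos (m.+1 + j)%N; lra.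
  apply: (@escape _ _ beta_gt1 (fun j => tail b x (m.+1 + j) - threshold b (m.+1 + j))).
    rewrite /= addn0 /= subr_gt0 gt_min; apply/orP; right.
    rewrite (lt_le_trans Hs) // lerD2r ler_pM2l //.
  move=> j _; rewrite addnS; move: (m.+1 + j)%N => i /=.
  set mm := Num.min _ _.
  have : mm <= beta * threshold b i - (b i)%:R by rewrite /mm ge_min lexx.
  lra.
have Hlt n : tail b x n < threshold b n.
  elim: n => [|n IH] /=; first by have := Hb 0%N; have := bound_lt; rewrite /=; lra.
  rewrite lt_min ltrD2r ltr_pM2l // IH /= /cap; case: ifP => [/Ht //|_].
  by have := Hb n.+1; have := bound_lt; rewrite /=; lra.
split=> [n|N]; first by have := Hlt n; have := Hb n; lra.
apply: contrapT => Hno.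
have Hstep n : (N <= n)%N -> threshold b n.+1 = beta * threshold b n - (b n)%:R.
  move=> Hn; apply/min_idPl; rewrite leNgt; apply/negP => Hs.
  by apply: Hno; exists n.
suff [j] : exists j, M%:R < threshold b (N + j) - tail b x (N + j).
  by have := threshold_le b (N + j); have := Hb (N + j)%N; lra.
apply: (@escape _ _ beta_gt1 (fun j => threshold b (N + j) - tail b x (N + j))).
  by rewrite /= addn0 subr_gt0.
move=> j _; rewrite addnS Hstep ?leq_addr //=; lra.
Qed.

Hypothesis pisot_beta : pisot beta.

Let c := maxn k M.

Lemma discrepancy_spectrum a b n : spectrum beta c (discrepancy a b n).
Proof.
elim: n => [|n IH].
  by rewrite /discrepancy subrr; apply: (@spectrum_int _ _ _ 0).
rewrite (_ : discrepancy _ _ _ = beta * discrepancy a b n + ((a n)%:Z - (b n)%:Z)%:~R).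
  by apply: spectrum_step => //; have := ltn_ord (a n); have := ltn_ord (b n);
    rewrite /c; lia.
by rewrite /discrepancy /= intrB; ring.
Qed.

Lemma spectrum_digit y (b : digit) : spectrum beta c y ->
  spectrum beta c (beta * y - b%:R).
Proof.
move=> Hy; rewrite (_ : - b%:R = (- b%:Z)%:~R); last by rewrite intrN.
by apply: spectrum_step => //; have := ltn_ord b; rewrite /c; lia.
Qed.

Lemma threshold_spectrum b n : spectrum beta c (threshold b n).
Proof.
have HM : spectrum beta c M%:R by apply: (@spectrum_int _ _ _ M); rewrite /c; lia.
have H1 : spectrum beta c 1 by apply: (@spectrum_int _ _ _ 1); rewrite /c; lia.
elim: n => [|n IH] //=; rewrite /Order.min /cap.
by do ?case: ifP => // _; exact: spectrum_digit.
Qed.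

Lemma ceiling_spectrum b n : spectrum beta c (ceiling b n).
Proof.
have HM : spectrum beta c M%:R by apply: (@spectrum_int _ _ _ M); rewrite /c; lia.
have H1 : spectrum beta c 1 by apply: (@spectrum_int _ _ _ 1); rewrite /c; lia.
elim: n => [|n IH] //=; rewrite /Order.min.
by do ?case: ifP => // _; exact: spectrum_digit.
Qed.

Lemma pisot_computable : normalization_computable beta.
Proof.
have [F HF] := (finite_seqP _).1 (finite_bounded_spectrum c M%:R pisot_beta).
have FP y : (y \in F) <-> spectrum beta c y /\ `|y| <= M%:R.
  have E : [set` F] y = (spectrum beta c `&` [set y | `|y| <= M%:R]) y by rewrite HF.
  by split=> [H|H]; [have : [set` F] y by []; rewrite E|have : [set` F] y by rewrite E].
(* Membership in [F] enforces the bound on the discrepancy. The Boolean records [slack] on the last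
   transition, since acceptance is read off states. *)
pose Q : finType := (seq_sub F * seq_sub F * seq_sub F * bool)%type.
pose step (q : Q) (a b : digit) (q' : Q) : Prop :=
  let: (s, t, u, _) := q in let: (s', t', u', f') := q' in
  [/\ ssval s' = beta * ssval s + a%:R - b%:R,
      ssval t' = Num.min (beta * ssval t - b%:R) (cap b),
      ssval u' = Num.min (beta * ssval u - b%:R) M%:R,
      0 < ssval t' /\ 0 <= ssval u' &
      f' = (cap b < beta * ssval t - b%:R)].
pose A : buchi (digit * digit)%type := @Buchi _ Q
  [set e | `[< step e.1.1 e.1.2.1 e.1.2.2 e.2 >]]%SET
  [set q | [&& ssval q.1.1.1 == 0, ssval q.1.1.2 == M%:R & ssval q.1.2 == 1]]%SET
  [set q | q.2]%SET.
exists A; apply/seteqP; split=> [ab|ab].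
- move=> [q Hp [Hi Hs]].
  pose a n := (ab n).1; pose b n := (ab n).2.
  have Hstep n : step (q n) (a n) (b n) (q n.+1).
    by have := Hp n; rewrite inE => /asboolP.
  have Hq n : [/\ ssval (q n).1.1.1 = discrepancy a b n,
      ssval (q n).1.1.2 = threshold b n & ssval (q n).1.2 = ceiling b n].
    elim: n => [|n [IH1 IH2 IH3]].
      move: Hi; rewrite inE => /and3P[/eqP -> /eqP -> /eqP ->].
      by rewrite /discrepancy subrr.
    move: (Hstep n) IH1 IH2 IH3; rewrite /step.
    case: (q n) => [[[s t] u] f]; case: (q n.+1) => [[[s' t'] u'] f'] /=.
    move=> [-> -> -> _ _] -> -> ->; split=> //.
    by rewrite /discrepancy /=; ring.
  have [x Hx] := rep_exists beta_gt1 a; have [y Hy] := rep_exists beta_gt1 b.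
  have xy : x = y.
    apply/(discrepancyP Hx Hy) => n; have [<- _ _] := Hq n.
    by have /FP[] := ssvalP (q n).1.1.1.
  subst y.
  have x1 : x <= 1.
    apply/(ceilingP Hy) => -[|n]; first exact: ler01.
    have [_ _ <-] := Hq n.+1; have := Hstep n; rewrite /step.
    by case: (q n) => [[[s t] u] f]; case: (q n.+1) => [[[s' t'] u'] f'] /= [_ _ _ []].
  exists x; split=> //.
    by rewrite x1 andbT; case/andP: (rep_tail_bounds beta_gt1 Hx 0%N).
  apply/(greedyP beta_gt1); split=> //; apply/(thresholdP Hy); split.
    case=> [|n]; first by have := cap_ge1; rewrite /=; lra.
    have [_ <- _] := Hq n.+1; have := Hstep n; rewrite /step.
    by case: (q n) => [[[s t] u] f]; case: (q n.+1) => [[[s' t'] u'] f'] /= [_ _ _ []].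
  (* A terminal state at time n + 1 means slack at time n; starting from [N.+1] excludes time 0. *)
  move=> N; have [[|n] Hn Hf] := Hs N.+1; first by [].
  exists n => //; rewrite /slack; have [_ <- _] := Hq n.
  move: Hf; rewrite inE; have := Hstep n; rewrite /step.
  by case: (q n) => [[[s t] u] f]; case: (q n.+1) => [[[s' t'] u'] f'] /= [_ _ _ _ ->].
- move=> [x [/andP[x0 x1] Ha /(greedyP beta_gt1)[Hb Hg]]].
  set a := fun i => (ab i).1 in Ha; set b := fun i => (ab i).2 in Hb Hg.
  have Hd := (discrepancyP Ha Hb).2 erefl.
  have Hc := (ceilingP Hb).2 x1.
  have [Ht Hinf] := (thresholdP Hb).2 Hg.
  have Fd n : discrepancy a b n \in F.
    by apply/FP; split=> //; exact: discrepancy_spectrum.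
  have Ft n : threshold b n \in F.
    apply/FP; split; first exact: threshold_spectrum.
    by rewrite ger0_norm ?threshold_le // ltW.
  have Fc n : ceiling b n \in F.
    apply/FP; split; first exact: ceiling_spectrum.
    by rewrite ger0_norm ?ceiling_le.
  pose q n : Q := (SeqSub (Fd n), SeqSub (Ft n), SeqSub (Fc n),
    if n is m.+1 then slack b m else false).
  exists q.
    move=> n; rewrite inE; apply/asboolP; split=> //=.
      by rewrite /discrepancy /=; ring.
    by split; [exact: (Ht n.+1)|exact: (Hc n.+1)].
  split; first by rewrite inE /= /discrepancy subrr !eqxx.
  move=> N; have [n Hn Hsl] := Hinf N.
  by exists n.+1; [rewrite leqW|rewrite inE].
Qed.

End Normalizer.

Theorem corollary4p5 (R : realType) (beta : R) (hbeta : 1 < beta) :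
  normalization_computable beta <-> pisot beta.
Proof.
split; first exact: computable_pisot.
by move=> H; exact: pisot_computable.
Qed.
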